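(* Let $\mathcal{P}$ be a finite classical polar space of rank $d$ over $\mathbb{F}_q$ with parameter $e$, and let $\mathcal{L}$ be a degree one Cameron-Liebler set of generators of $\mathcal{P}$ with parameter $x$. If $x\le q^{e-1}+1$, then either $\mathcal{L}$ is the union of $x$ point-pencils whose vertices are pairwise non-collinear, or $x=q^{e-1}+1$ and $\mathcal{L}$ is the set of generators of an embedded polar space of rank $d$ with parameter $e-1$.
   Context: The finite classical polar spaces of rank $d$ are $Q^+(2d-1,q)$, $H(2d-1,q)$ ($q$ a square), $W(2d-1,q)$, $Q(2d,q)$, $H(2d,q)$ ($q$ a square), $Q^-(2d+1,q)$; generators are totally isotropic subspaces of maximal projective dimension $d-1$. The parameter $e$ (every $(d-2)$-space lies in exactly $q^e+1$ generators) is $0,\tfrac12,1,1,\tfrac32,2$ respectively. With $A$ the real point-generator incidence matrix, a set $\mathcal{L}$ of generators with characteristic vector $\chi$ is a degree one Cameron-Liebler set if $\chi\in\mathrm{im}(A^T)$; its parameter is $x=|\mathcal{L}|/\prod_{k=0}^{d-2}(q^{e+k}+1)$. A point-pencil with vertex $P$ is the set of all generators through the point $P$. An embedded polar space of rank $d$ is a polar space contained in $\mathcal{P}$ (on a subspace/subform) whose generators are also generators of $\mathcal{P}$. *)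

(* Defs.v *)
From HB Require Import structures.
From mathcomp Require Import all_boot all_order all_algebra sesquilinear.
From mathcomp Require Import boolp reals exp.

Set Implicit Arguments.
Unset Strict Implicit.
Unset Printing Implicit Defensive.

Import Order.TTheory GRing.Theory Num.Theory.
Local Open Scope ring_scope.

Section FiniteVspace.
Import VectorInternalTheory.

(* Over a finite field, {vspace V} is a subtype of a finite type of matrices. *)
HB.instance Definition _ (F : finFieldType) (V : vectType F) :=
  [Countable of {vspace V} by <:].
HB.instance Definition _ (F : finFieldType) (V : vectType F) :=
  [Finite of {vspace V} by <:].

End FiniteVspace.

(* The six families, in order of increasing parameter e:                      *)
(*   Q+(2d-1,q), H(2d-1,q), W(2d-1,q), Q(2d,q), H(2d,q), Q-(2d+1,q).          *)
Variant polar_family : Type :=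
  | Hyperbolic | HermitianOdd | Symplectic
  | Parabolic | HermitianEven | Elliptic.

Definition polar_e (R : realType) (t : polar_family) : R :=
  match t with
  | Hyperbolic => 0
  | HermitianOdd => 1 / 2
  | Symplectic => 1
  | Parabolic => 1
  | HermitianEven => 3 / 2
  | Elliptic => 2
  end.

(* Vector space dimension, i.e. one more than the projective dimension. *)
Definition polar_vdim (t : polar_family) (d : nat) : nat :=
  match t with
  | Hyperbolic | HermitianOdd | Symplectic => (2 * d)%N
  | Parabolic | HermitianEven => (2 * d).+1%N
  | Elliptic => (2 * d).+2%N
  end.

Section PolarSpace.
Variables (F : finFieldType) (V : vectType F).

Definition polarization (Q : V -> F) (u v : V) : F := Q (u + v) - Q u - Q v.

Definition quadratic_form (Q : V -> F) : Prop :=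
  (forall a v, Q (a *: v) = a ^+ 2 * Q v) /\
  bilinear_for *%R *%R (polarization Q).

(* In characteristic 2 the polarization itself may be degenerate (always so   *)
(* for Q(2d,q)): only singular vectors are excluded from its radical.         *)
Definition quadratic_nondegenerate (Q : V -> F) : Prop :=
  forall v, Q v = 0 -> (forall u, polarization Q u v = 0) -> v = 0.

Variant polar_form : Type :=
  | QuadraticForm of V -> F
  | SymplecticForm of {skew_symmetric V}
  | HermitianForm (theta : {rmorphism F -> F}) of {hermitian_sym V for theta}.

(* A field automorphism of order 2 exists only when #|F| is a square, and it  *)
(* is then x |-> x ^+ sqrt #|F|.                                              *)
Definition polar_form_axiom (f : polar_form) : Prop :=
  match f with
  | QuadraticForm Q => quadratic_form Q /\ quadratic_nondegenerate Q
  | SymplecticForm b => is_psymplectic b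
  | HermitianForm theta h =>
      [/\ involutive theta, ~ theta =1 id & is_unitary h]
  end.

Definition isotropic (f : polar_form) (U : {vspace V}) : Prop :=
  match f with
  | QuadraticForm Q => {in U, forall v, Q v = 0}
  | SymplecticForm b => {in U &, forall u v, b u v = 0}
  | HermitianForm theta h => {in U &, forall u v, h u v = 0}
  end.

Definition polar_rank (f : polar_form) : nat :=
  \max_(U : {vspace V} | `[< isotropic f U >]) \dim U.

Definition in_family (t : polar_family) (f : polar_form) : Prop :=
  match t, f with
  | (Hyperbolic | Parabolic | Elliptic), QuadraticForm _ => True
  | Symplectic, SymplecticForm _ => True
  | (HermitianOdd | HermitianEven), HermitianForm _ _ => True
  | _, _ => False
  end.

Definition classical_polar_space (t : polar_family) (d : nat)
    (f : polar_form) : Prop :=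
  [/\ (0 < d)%N, polar_form_axiom f, polar_rank f = d, in_family t f
    & \dim {:V} = polar_vdim t d].

Definition points (f : polar_form) : {set {vspace V}} :=
  [set U | `[< isotropic f U >] & \dim U == 1%N].

Definition generators (f : polar_form) : {set {vspace V}} :=
  [set U | `[< isotropic f U >] & \dim U == polar_rank f].

Definition collinear (f : polar_form) (P P' : {vspace V}) : Prop :=
  isotropic f (P + P')%VS.

Definition point_pencil (f : polar_form) (P : {vspace V}) : {set {vspace V}} :=
  [set G in generators f | (P <= G)%VS].

Section Incidence.
Variable R : realType.

Definition incidence_mx (f : polar_form) :
    'M[R]_(#|points f|, #|generators f|) :=
  \matrix_(i, j) ((enum_val i <= enum_val j)%VS)%:R.

Definition char_vec (f : polar_form) (L : {set {vspace V}}) :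
    'cV[R]_#|generators f| :=
  \col_j (enum_val j \in L)%:R.

Definition degree_one_CL (f : polar_form) (L : {set {vspace V}}) : Prop :=
  L \subset generators f /\
  exists v, char_vec f L = (incidence_mx f)^T *m v.

Definition CL_parameter (t : polar_family) (d : nat)
    (L : {set {vspace V}}) : R :=
  #|L|%:R /
    \prod_(k < d.-1) ((#|F|%:R : R) `^ (polar_e R t + k%:R) + 1).

End Incidence.

Definition union_of_pencils (f : polar_form) (S L : {set {vspace V}}) : Prop :=
  [/\ S \subset points f,
      {in S &, forall P P', P != P' -> ~ collinear f P P'}
    & L = \bigcup_(P in S) point_pencil f P].

End PolarSpace.

Section Embedded.
Variables (F : finFieldType) (V : vectType F).

Definition vs_lift (W : {vspace V}) (U : {vspace subvs_of W}) : {vspace V} :=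
  (linfun vsval @: U)%VS.

(* The polar space of g, living on W, is contained in that of f, and its      *)
(* generators are generators of f.                                            *)
Definition embedded_in (f : polar_form V) (W : {vspace V})
    (g : polar_form (subvs_of W)) : Prop :=
  (forall U, isotropic g U -> isotropic f (vs_lift U)) /\
  {in generators g, forall U, vs_lift U \in generators f}.

Definition embedded_generators (W : {vspace V})
    (g : polar_form (subvs_of W)) : {set {vspace V}} :=
  [set vs_lift U | U in generators g].

End Embedded.

(* Main.v *)
Require Import Defs.
From HB Require Import structures.
From mathcomp Require Import all_boot all_order all_algebra finfield sesquilinear.
From mathcomp Require Import boolp reals exp.
From mathcomp Require Import zify ring lra.

(* Let q = |F| and E = q^e, and write the characteristic function of [L] at a generator
   as the sum wt of weights over its points.  For an isotropic [U] of dimension k put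
   x_U = E q^(d-1-k) wt(U) + wt(U^perp); this is the parameter of [L] in the residue of
   [U], and x_0 = x.  Double counting relates x_W, x_U and the x_(U + <u>) for U < W
   and u in W; by descending induction it gives x_P <= x for every point P that is not
   full, i.e. not the vertex of a pencil contained in [L].  Summed over the points of a
   generator in [L] without full point, the same identity gives x >= E/q + 1.  Removing
   a full pencil lowers x by 1, so either every element of [L] contains a full point,
   or x = E/q + 1, no point is full, and x_P = x for all points P on elements of [L].

   In the second case a vector is "covered" if it lies on an element of [L].  Covered
   vectors are closed under orthogonal sums, and exactly E/q + 1 elements of [L] pass
   through a covered isotropic subspace of dimension d - 1.  For two disjoint elements
   G1, G2 of [L], all singular vectors of G1 + G2 are covered (in the quadratic and
   Hermitian cases, and for symplectic forms in odd characteristic, where this is absurd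
   since G1 + G2 = V).  For elliptic quadrics G1 + G2 is enlarged by one covered vector.
   This yields a hyperplane W whose singular vectors are exactly the covered ones, and
   [L] comes from the restriction of the form to W.  For symplectic forms in
   characteristic 2 the covered vectors are the zeros of Q(y + y') = b(y, y'), y in G1,
   y' in G2, a hyperbolic quadratic form with polarization b. *)
Set Implicit Arguments.
Unset Strict Implicit.
Unset Printing Implicit Defensive.

Import Order.TTheory GRing.Theory Num.Theory.
Local Open Scope ring_scope.

(** * Polarities *)

Lemma sum_const_in (R : nzRingType) (T : finType) (P : pred T) (a : R) :
  \sum_(u | P u) a = #|[set u | P u]|%:R * a.
Proof. by rewrite sumr_const cardsE mulr_natl. Qed.

Lemma sum_nat_const_in (T : finType) (P : pred T) (n : nat) :
  (\sum_(u | P u) n = #|[set u | P u]| * n)%N.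
Proof. by rewrite sum_nat_const cardsE. Qed.

Lemma exchange_weight (R : nzRingType) (S T : finType) (P : pred S)
    (Q : S -> pred T) (w : T -> R) :
  \sum_(u | P u) \sum_(r | Q u r) w r =
  \sum_r #|[set u | P u && Q u r]|%:R * w r.
Proof.
rewrite (exchange_big_dep xpredT) //=; apply: eq_bigr => r _.
by rewrite sum_const_in.
Qed.

(** * Vectors and subspaces over a finite field *)

Section FiniteLinear.
Variables (F : finFieldType) (V : vectType F).
Local Notation vT := (finvect_type V).
Implicit Types (A B U : {vspace V}) (u v : V).

Lemma card_subspace U : #|[set u : vT | (u : V) \in U]| = (#|F| ^ \dim U)%N.
Proof.
rewrite cardsE; case: V U => T cT U.
exact: (@card_vspace F (finvect_type (Vector.Pack cT)) cT U).
Qed.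

Lemma card_field_gt1 : (1 < #|F|)%N.
Proof. exact: finNzRing_gt1. Qed.

Lemma subv_line u U : (<[u]> <= U)%VS = (u \in U).
Proof. by rewrite memvE. Qed.

Lemma dim_add_line U u : u \notin U -> \dim (U + <[u]>)%VS = (\dim U).+1.
Proof.
move=> uU; rewrite dimv_disjoint_sum.
  rewrite dim_vline; case: eqP uU => [->|_ _]; first by rewrite mem0v.
  by rewrite addn1.
apply/eqP; rewrite -subv0; apply/subvP => v; rewrite memv_cap memv0.
case/andP=> vU /vlineP [k vk]; apply: contraT => v0; case/negP: uU.
have k0 : k != 0 by apply: contraNneq v0 => k0; rewrite vk k0 scale0r.
by rewrite -(scalerK k0 u) -vk memvZ.
Qed.

Lemma mem_add_line U u v :
  reflect (exists k, v - k *: u \in U) (v \in U + <[u]>)%VS.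
Proof.
apply: (iffP memv_addP) => [[x xU [y /vlineP [k ->] ->]]|[k vkU]].
  by exists k; rewrite addrK.
by exists (v - k *: u) => //; exists (k *: u); rewrite ?subrK ?memvZ ?memv_line.
Qed.

Lemma add_line_exchange U u v : u \notin U -> v \notin U ->
  (v \in U + <[u]>)%VS = (u \in U + <[v]>)%VS.
Proof.
wlog suff main : u v / u \notin U -> v \notin U -> (v \in U + <[u]>)%VS ->
    (u \in U + <[v]>)%VS.
  by move=> uU vU; apply/idP/idP; apply: main.
move=> uU vU /mem_add_line [k vk]; apply/mem_add_line.
have k0 : k != 0 by apply: contraNneq vU => k0; rewrite k0 scale0r subr0 in vk.
exists k^-1; rewrite -memvN opprB; move: (memvZ k^-1 vk).
by rewrite scalerBr scalerA mulVf // scale1r.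
Qed.

Lemma add_lineS U A u : (U + <[u]> <= A)%VS = (U <= A)%VS && (u \in A).
Proof. by rewrite subv_add subv_line. Qed.

Lemma subvNP A B : reflect (exists2 u, u \in A & u \notin B) (~~ (A <= B)%VS).
Proof.
apply: (iffP idP) => [AB|[u uA uB]]; last first.
  by apply: contraNN uB => /subvP; apply.
have /existsP [u /andP [uA uB]] : [exists u : vT, ((u : V) \in A) && ((u : V) \notin B)].
  apply: contraR AB => /existsPn H; apply/subvP => u uA.
  by have := H u; rewrite uA negbK.
by exists u.
Qed.

Lemma dim_ltNsub A B : (\dim B < \dim A)%N -> exists2 u, u \in A & u \notin B.
Proof. by move=> h; apply/subvNP; apply: contraL h => /dimvS; rewrite leqNgt. Qed.

End FiniteLinear.

(* Common properties of the three kinds of forms.  [c] is the number of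
   singular vectors on the affine line [w + F u] for a singular [u] not
   orthogonal to [w]: 1, sqrt q and q for quadratic, Hermitian and symplectic
   forms. *)
Record polarity (F : finFieldType) (V : vectType F) (c : nat) := Polarity {
  sg : pred V;
  bf : V -> 'Hom(V, F^o);
  bf_refl : forall u v, bf v u = 0 -> bf u v = 0;
  sg0 : sg 0;
  sgZ : forall a u, sg u -> sg (a *: u);
  sgD : forall u v, sg u -> sg v -> bf v u = 0 -> sg (u + v);
  bf_sg : forall u, sg u -> bf u u = 0;
  sg_line : forall u w, sg u -> bf u w != 0 ->
    #|[set a : F | sg (w + a *: u)]| = c;
  sg_nondeg : forall u, sg u -> (forall v, bf u v = 0) -> u = 0
}.

Section Polarity.
Variables (F : finFieldType) (V : vectType F) (c : nat) (p : polarity V c).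
Local Notation vT := (finvect_type V).
Local Notation q := #|F|.
Local Notation sg := (sg p).
Local Notation bf := (bf p).
Implicit Types (A B U W G : {vspace V}) (u v : V).

Definition perp u : {vspace V} := lker (bf u).

Lemma mem_perp u v : (v \in perp u) = (bf u v == 0).
Proof. by rewrite memv_ker. Qed.

Lemma perpP u v : reflect (bf u v = 0) (v \in perp u).
Proof. by rewrite mem_perp; apply: eqP. Qed.

Lemma perpC u v : (v \in perp u) = (u \in perp v).
Proof. by rewrite !mem_perp; apply/eqP/eqP => /bf_refl. Qed.

Lemma perp0 v : v \in perp 0.
Proof. by rewrite perpC mem0v. Qed.

Lemma mem_perpZ a u v : v \in perp u -> v \in perp (a *: u).
Proof. by rewrite !(perpC _ v) => h; apply: memvZ. Qed.

Lemma mem_perpD u1 u2 v : v \in perp u1 -> v \in perp u2 -> v \in perp (u1 + u2).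
Proof. by rewrite !(perpC _ v) => h1 h2; apply: memvD. Qed.

Definition orth U : {vspace V} := (\bigcap_(u : vT | (u : V) \in U) perp u)%VS.

Lemma orthP U v : reflect (forall u, u \in U -> v \in perp u) (v \in orth U).
Proof.
rewrite memvE; apply: (iffP subv_bigcapP) => h u; last first.
  by move=> uU; rewrite -memvE; apply: h.
by move=> uU; have := h u uU; rewrite -memvE.
Qed.

Lemma orthE U v : (v \in orth U) = (U <= perp v)%VS.
Proof.
apply/orthP/subvP => h u /h; by rewrite perpC.
Qed.

Lemma subv_orthC A B : (A <= orth B)%VS = (B <= orth A)%VS.
Proof.
apply/subvP/subvP => h u uA; apply/orthP => v /h /orthP; rewrite perpC; exact.
Qed.

Lemma orthS A B : (A <= B)%VS -> (orth B <= orth A)%VS.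
Proof. by move=> /subvP AB; apply/subvP => v /orthP h; apply/orthP => u /AB /h. Qed.

Lemma orth_add_line U u : orth (U + <[u]>)%VS = (orth U :&: perp u)%VS.
Proof. by apply/vspaceP => v; rewrite memv_cap !orthE add_lineS (perpC u v). Qed.

Lemma orth0 : orth 0 = fullv.
Proof. by apply/vspaceP => v; rewrite memvf orthE sub0v. Qed.

Lemma dim_cap_perp A u :
  \dim (A :&: perp u) = if (A <= perp u)%VS then \dim A else (\dim A).-1.
Proof.
case: ifP => [/capv_idPl -> //|]; move=> /negbT /subvNP [v vA vu].
rewrite -(limg_ker_dim (bf u) A).
suff -> : \dim (bf u @: A) = 1%N by rewrite addn1.
apply/eqP; rewrite eqn_leq; apply/andP; split.
  by have := dimvS (subvf (bf u @: A)); rewrite dimvf.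
rewrite lt0n dimv_eq0; apply: contraNneq vu => h.
by rewrite mem_perp -memv0 -h memv_img.
Qed.

(** Orthogonality is demanded besides singularity because for symplectic forms every vector is
    singular. *)
Definition iso U := [forall u : vT, ((u : V) \in U) ==> sg u && (U <= perp u)%VS].

Lemma isoP U : reflect (forall u, u \in U -> sg u /\ (U <= perp u)%VS) (iso U).
Proof.
apply: (iffP forallP) => h u.
  by move=> uU; have := h u; rewrite uU => /andP.
by apply/implyP => /h [-> ->].
Qed.

Lemma iso_sg U u : iso U -> u \in U -> sg u.
Proof. by move=> /isoP h /h []. Qed.

Lemma iso_perp U u v : iso U -> u \in U -> v \in U -> v \in perp u.
Proof. by move=> /isoP h /h [_ /subvP]; apply. Qed.

Lemma iso_orth U : iso U -> (U <= orth U)%VS.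
Proof.
by move=> i; apply/subvP => u uU; apply/orthP => v vU; apply: iso_perp vU uU.
Qed.

Lemma isoS A B : (A <= B)%VS -> iso B -> iso A.
Proof.
move=> AB /isoP h; apply/isoP => u /(subvP AB) /h [-> uB]; split=> //.
exact: subv_trans uB.
Qed.

Lemma iso0 : iso 0.
Proof.
by apply/isoP => u; rewrite memv0 => /eqP ->; rewrite sub0v sg0.
Qed.

Lemma iso_add A B : iso A -> iso B -> (A <= orth B)%VS -> iso (A + B)%VS.
Proof.
move=> iA iB AB; have BA : (B <= orth A)%VS by rewrite subv_orthC.
apply/isoP => u /memv_addP [a aA [b bB ->]].
have ab : a \in perp b by have /orthP := subvP AB a aA; apply.
split; first by apply: sgD; [exact: iso_sg aA | exact: iso_sg bB | exact/perpP].
apply/subvP => v /memv_addP [a' a'A [b' b'B ->]].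
have ab' : a' \in perp b by have /orthP := subvP AB a' a'A; apply.
have a'b : b' \in perp a by have /orthP := subvP BA b' b'B; apply.
apply: memvD; apply: mem_perpD => //; [exact: iso_perp aA a'A | exact: iso_perp bB b'B].
Qed.

Lemma iso_line u : sg u -> iso <[u]>.
Proof.
move=> su; apply/isoP => v /vlineP [k ->]; split; first exact: sgZ.
by rewrite subv_line mem_perpZ // mem_perp bf_sg.
Qed.

Lemma iso_add_line U u : iso U -> sg u -> u \in orth U -> iso (U + <[u]>)%VS.
Proof.
move=> iU su uU; apply: iso_add => //; first exact: iso_line.
by rewrite subv_orthC subv_line.
Qed.

Lemma iso_add_lineP U u : iso (U + <[u]>)%VS -> [/\ iso U, sg u & u \in orth U].
Proof.
move=> i; have uU : u \in (U + <[u]>)%VS by rewrite (subvP (addvSr _ _)) ?memv_line.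
split; first exact: isoS (addvSl _ _) i.
  exact: iso_sg i uU.
have /subvP/(_ u uU) := iso_orth i.
by apply/subvP; rewrite orthS // addvSl.
Qed.

Lemma card_perp_exchange A B :
  \sum_(u : vT | (u : V) \in A) #|[set v : vT | (v : V) \in (B :&: perp u)%VS]| =
  \sum_(v : vT | (v : V) \in B) #|[set u : vT | (u : V) \in (A :&: perp v)%VS]|.
Proof.
under eq_bigr do rewrite -sum1dep_card.
under [RHS]eq_bigr do rewrite -sum1dep_card.
rewrite (exchange_big_dep (fun v : vT => (v : V) \in B)) /=; last first.
  by move=> u v _; rewrite memv_cap => /andP [].
apply: eq_bigr => v vB; apply: eq_bigl => u.
by rewrite !memv_cap vB /= (perpC u v).
Qed.

Let q_gt1 : (1 < q)%N := card_field_gt1 F.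
Let q_gt0 : (0 < q)%N := ltnW q_gt1.

(** A [polarity] does not make [bf] linear in its first argument, so orthogonal pairs in V x U are
    counted twice instead. A vector of V is orthogonal to all of U or to a hyperplane of it; a
    nonzero vector of U is singular, so by [sg_nondeg] it is orthogonal to a hyperplane of V
    only. *)
Lemma dim_orth U : iso U -> (\dim (orth U) + \dim U)%N = \dim {:V}.
Proof.
move=> iU; set n := \dim {:V}; set k := \dim U.
have [k0|k_gt0] := posnP k.
  have U0 : U = 0%VS by apply/eqP; rewrite -dimv_eq0 -/k k0.
  by rewrite k0 addn0 U0 orth0.
have kn : (k <= n)%N := dimvS (subvf U).
have main := card_perp_exchange fullv U.
rewrite (bigID (fun u : vT => (u : V) \in orth U)) /= in main.
rewrite (eq_bigr (fun _ => q ^ k)%N) in main; last first.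
  by move=> u /andP [_]; rewrite orthE => uU; rewrite card_subspace dim_cap_perp uU.
rewrite [X in (_ + X)%N = _](eq_bigr (fun _ => q ^ k.-1)%N) in main; last first.
  move=> u /andP [_]; rewrite orthE => uU.
  by rewrite card_subspace dim_cap_perp (negbTE uU).
rewrite !sum_nat_const_in [RHS](bigD1 (0 : vT)) ?mem0v //= in main.
rewrite [X in _ = (_ + X)%N](eq_bigr (fun _ => q ^ n.-1)%N) in main; last first.
  move=> u /andP [uU u0]; rewrite card_subspace dim_cap_perp ifN //.
  apply: contraNN u0 => /subvP h; apply/eqP; apply: (sg_nondeg (p := p)).
    exact: iso_sg uU.
  by move=> v; apply/perpP; rewrite h ?memvf.
rewrite card_subspace sum_nat_const_in in main.
have e0 : (fullv :&: perp 0)%VS = fullv.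
  by apply/capv_idPl/subvP => v _; rewrite perp0.
rewrite {}e0 in main; move: main.
set a := (X in (X * q ^ k + _)%N); set b := (X in (_ + X * q ^ k.-1)%N).
set e := (X in (_ + X * q ^ n.-1)%N).
have aE : a = (q ^ \dim (orth U))%N.
  by rewrite -card_subspace; apply: eq_card => u; rewrite !inE memvf.
have abE : (a + b)%N = (q ^ n)%N.
  rewrite -[n]/(\dim fullv) -card_subspace /a /b -cardUI [X in (_ + X)%N]eq_card0 ?addn0.
    by apply: eq_card => u; rewrite !inE memvf /= orbN.
  by move=> u; rewrite !inE memvf /= andbN.
have eE : (e.+1)%N = (q ^ k)%N.
  rewrite /k -card_subspace (cardD1 (0 : vT)) inE mem0v add1n; congr _.+1.
  by apply: eq_card => u; rewrite !inE andbC.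
clearbody a b e; have n_gt0 : (0 < n)%N by apply: leq_trans kn.
rewrite -/n => main.
have : (a * (q ^ k * (q - 1)) = q ^ n * (q - 1))%N.
  have e1 : (q ^ k = q * q ^ k.-1)%N by rewrite -expnS prednK.
  have e2 : (q ^ n = q * q ^ n.-1)%N by rewrite -expnS prednK.
  rewrite e1 e2; rewrite e1 in main eE; rewrite e2 in abE main.
  have : (q * (q ^ n.-1) = a * 1 + b)%N by rewrite muln1.
  move: (q_gt0) main eE abE; move: (q ^ k.-1)%N (q ^ n.-1)%N => x y.
  case: (q) => // r _; rewrite subn1 /=; nia.
rewrite aE mulnA -expnD => /eqP; rewrite eqn_pmul2r ?subn_gt0 //.
by rewrite eqn_exp2l // => /eqP.
Qed.

Section Rank.
Variable d : nat.
Hypothesis iso_le : forall U, iso U -> (\dim U <= d)%N.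

(** The new vector is found inside G. Counting orthogonal pairs in G x U, where each vector of U is
    orthogonal to at least a hyperplane of G, shows that the dimension of G meet U^perp is at least
    that of U meet G plus d - dim U. *)
Lemma iso_extend G U : iso G -> \dim G = d -> iso U -> (\dim U < d)%N ->
  exists u, [/\ u \notin U, sg u & u \in orth U].
Proof.
move=> iG dG iU dU.
suff : (\dim (U :&: G) < \dim (G :&: orth U))%N.
  move=> /dim_ltNsub [u]; rewrite !memv_cap => /andP [uG uU].
  rewrite uG andbT => unU; exists u; split=> //; exact: iso_sg uG.
set m := \dim (U :&: G); set k := \dim U in dU *; set r := \dim (G :&: _).
have main := card_perp_exchange G U.
rewrite (bigID (fun u : vT => (u : V) \in orth U)) /= in main.
rewrite (eq_bigr (fun _ => q ^ k)%N) in main; last first.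
  by move=> u /andP [_]; rewrite orthE => uU; rewrite card_subspace dim_cap_perp uU.
rewrite [X in (_ + X)%N = _](eq_bigr (fun _ => q ^ k.-1)%N) in main; last first.
  move=> u /andP [_]; rewrite orthE => uU.
  by rewrite card_subspace dim_cap_perp (negbTE uU).
rewrite !sum_nat_const_in in main.
rewrite [RHS](bigID (fun u : vT => (u : V) \in G)) /= in main.
rewrite [X in _ = (X + _)%N](eq_bigr (fun _ => q ^ d)%N) in main; last first.
  move=> u /andP [_ uG]; rewrite card_subspace (capv_idPl _) ?dG //.
  by have /isoP/(_ u uG) [] := iG.
move: main.
set s := (X in (_ = _ + X)%N).
set a := (X in (X * q ^ k + _)%N); set b := (X in (_ + X * q ^ k.-1)%N).
rewrite sum_nat_const_in; set e := (X in (X * q ^ d + _)%N).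
have aE : a = (q ^ r)%N.
  by rewrite -card_subspace; apply: eq_card => u; rewrite !inE memv_cap.
have abE : (a + b)%N = (q ^ d)%N.
  rewrite -dG -card_subspace /a /b -cardUI [X in (_ + X)%N]eq_card0 ?addn0.
    by apply: eq_card => u; rewrite !inE -andb_orr orbN andbT.
  by move=> u; rewrite !inE andbACA andbN andbF.
have eE : e = (q ^ m)%N.
  by rewrite -card_subspace; apply: eq_card => u; rewrite !inE memv_cap.
have sE : ((q ^ k - q ^ m) * q ^ d.-1 <= s)%N.
  have -> : (q ^ k - q ^ m = #|[set u : vT | ((u : V) \in U) && ((u : V) \notin G)]|)%N.
    rewrite /k /m -!card_subspace.
    rewrite -(cardsID [set u : vT | (u : V) \in G] [set u : vT | (u : V) \in U]).
    rewrite (_ : _ :&: _ = [set u : vT | (u : V) \in (U :&: G)%VS]).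
      by rewrite addKn; apply: eq_card => u; rewrite !inE andbC.
    by apply/setP => u; rewrite !inE memv_cap.
  rewrite -sum_nat_const /s big_mkcond /= [X in (_ <= X)%N]big_mkcond /=.
  apply: leq_sum => u _; rewrite inE; case: ifP => // _.
  by rewrite card_subspace dim_cap_perp leq_exp2l //; case: ifP; rewrite dG ?leq_pred.
have mk : (m <= k)%N by apply: dimvS; apply: capvSl.
clearbody a b e s.
have [k0|k_gt0] := posnP k.
  move=> _; have U0 : U = 0%VS by apply/eqP; rewrite -dimv_eq0 -/k k0.
  move: mk; rewrite k0 leqn0 => /eqP ->.
  by rewrite /r U0 orth0 capvf dG -k0.
move=> main; rewrite -(ltn_exp2l _ _ q_gt1) -/r.
rewrite -aE -eE.
have e1 : (q ^ k = q * q ^ k.-1)%N by rewrite -expnS prednK.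
have e2 : (q ^ d = q * q ^ d.-1)%N by rewrite -expnS prednK // (leq_trans _ dU).
have kd : (q ^ k.-1 < q ^ d.-1)%N.
  by rewrite ltn_exp2l // -ltnS !prednK // (leq_trans _ dU).
have mk2 : (e <= q ^ k)%N by rewrite eE leq_exp2l.
have xpos : (0 < q ^ k.-1)%N by rewrite expn_gt0 q_gt0.
have epos : (0 < e)%N by rewrite eE expn_gt0 q_gt0.
rewrite e1 e2 -eE in main abE sE mk2.
have abE' : b = (q * q ^ d.-1 - a)%N by rewrite -abE addKn.
have ale : (a <= q * q ^ d.-1)%N by rewrite -abE leq_addr.
have : (a * (q ^ k.-1 * (q - 1)) >= e * (q ^ d.-1 * (q - 1)))%N.
  move: (q_gt1) main sE abE mk2; move: (q ^ k.-1)%N (q ^ d.-1)%N => x y.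
  case: (q) => // t; rewrite subn1 /= => t1; nia.
have -> : (a * (q ^ k.-1 * (q - 1)) = a * q ^ k.-1 * (q - 1))%N by rewrite mulnA.
rewrite mulnA leq_pmul2r ?subn_gt0 // => h.
rewrite -(ltn_pmul2r xpos); apply: leq_trans h.
by rewrite ltn_pmul2l.
Qed.

End Rank.
End Polarity.

(** * Counting and point weights *)

Section Counting.
Variables (F : finFieldType) (V : vectType F) (c : nat) (p : polarity V c).
Variables (d m : nat) (R : realFieldType).
Local Notation vT := (finvect_type V).
Local Notation q := #|F|.
Local Notation sg := (sg p).
Local Notation perp := (perp p).
Local Notation orth := (orth p).
Local Notation iso := (iso p).
Implicit Types (A B U W G : {vspace V}) (u v : V).

Hypothesis iso_le : forall U, iso U -> (\dim U <= d)%N.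
Hypothesis iso_ex : exists2 G, iso G & \dim G = d.
Hypothesis dimV : \dim {:V} = (2 * d + m)%N.
(** This is q^e: c = 1 and m = 0, 1, 2 for hyperbolic, parabolic and elliptic quadrics, c = sqrt q
    and m = 0, 1 for Hermitian forms, c = q and m = 0 for symplectic forms. *)
Local Notation E := (c * q ^ m)%N.

Definition gens : {set {vspace V}} := [set G | iso G && (\dim G == d)].

Lemma gensP G : reflect (iso G /\ \dim G = d) (G \in gens).
Proof. by rewrite inE; apply: (iffP andP) => -[? /eqP]. Qed.

Lemma extend_iso U : iso U -> (\dim U < d)%N ->
  exists u, [/\ u \notin U, sg u & u \in orth U].
Proof. by case: iso_ex => G iG dG; apply: iso_extend iG dG. Qed.

Lemma sg_gen_orth G u : G \in gens -> sg u -> u \in orth G -> u \in G.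
Proof.
move=> /gensP [iG dG] su uG; apply: contraT => unG.
have := iso_le (iso_add_line iG su uG).
by rewrite dim_add_line // dG ltnn.
Qed.

Let q_gt1 : (1 < q)%N := card_field_gt1 F.
Let q_gt0 : (0 < q)%N := ltnW q_gt1.

Lemma card_diff A B : (B <= A)%VS ->
  (#|[set u : vT | ((u : V) \in A) && ((u : V) \notin B)]| + q ^ \dim B = q ^ \dim A)%N.
Proof.
move=> /subvP BA; rewrite -!card_subspace addnC.
rewrite -(cardsID [set u : vT | (u : V) \in B] [set u : vT | (u : V) \in A]).
congr (_ + _)%N; apply: eq_card => u; rewrite !inE //; last by rewrite andbC.
by apply/esym/andb_idl/BA.
Qed.

(* Translation by [F a] preserves [A \ a^perp], and each of its orbits contains
   [c] singular vectors. *)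
Lemma card_sg_notperp A a : sg a -> a \in A ->
  (#|[set v : vT | [&& sg v, (v : V) \in A & (v : V) \notin perp a]]| * q =
   c * #|[set v : vT | ((v : V) \in A) && ((v : V) \notin perp a)]|)%N.
Proof.
move=> sa aA; set T := [set v | _]; set D := [set v | _].
have aa : a \in perp a by rewrite mem_perp bf_sg.
have shift v t : (v + t *: a \in A) && (v + t *: a \notin perp a) =
    (v \in A) && (v \notin perp a).
  by rewrite !rpredDr ?memvZ.
transitivity (\sum_(t : F) \sum_(v in D) (sg (v + t *: a)%R : nat))%N.
  transitivity (\sum_(t : F) #|T|)%N; first by rewrite sum_nat_const mulnC.
  apply: eq_bigr => t _.
  have inj : injective (fun v : vT => v - t *: a : vT) by move=> x y /addIr.
  rewrite -(card_imset _ inj) -sum1_card [RHS]big_mkcond /= [LHS]big_mkcond /=.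
  apply: eq_bigr => v _.
  suff -> : (v \in (fun v : vT => v - t *: a : vT) @: T) = (v \in D) && sg (v + t *: a).
    by case: (v \in D); case: (sg _).
  apply/imsetP/andP => [[w + ->]|[+ sv]].
    by rewrite !inE -scaleNr shift scaleNr subrK => /and3P [-> -> ->].
  rewrite inE => vD; exists (v + t *: a : vT); rewrite ?addrK //.
  by rewrite inE sv shift.
rewrite exchange_big /= mulnC -sum_nat_const; apply: eq_bigr => v.
rewrite inE mem_perp => /andP [vA vp].
transitivity #|[set t : F | sg (v + t *: a)]|; last exact: sg_line sa vp.
rewrite -sum1dep_card [RHS]big_mkcond /=.
by apply: eq_bigr => t _; case: (sg _).
Qed.

(** The count is q^d + E (q^(d+j) - q^d) / q, cleared of subtraction and division. For a generator U
    the singular vectors of U^perp are those of U. Enlarging U by a singular vector a loses the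
    singular vectors of U^perp outside a^perp, which [card_sg_notperp] counts. *)
Lemma card_sg_orth j U : iso U -> (\dim U + j = d)%N ->
  (#|[set v : vT | sg v && ((v : V) \in orth U)]| * q + E * q ^ d =
   q ^ d.+1 + E * q ^ (d + j))%N.
Proof.
elim: j U => [|j IH] U iU dU.
  rewrite addn0 in dU; rewrite addn0; congr (_ + _)%N.
  rewrite expnSr -dU -card_subspace; congr (_ * _)%N; apply: eq_card => v.
  rewrite !inE; apply/andP/idP => [[sv vU]|vU].
    by apply: sg_gen_orth vU => //; apply/gensP.
  by rewrite (iso_sg iU vU) (subvP (iso_orth iU)).
have [|a [aU sa aoU]] := extend_iso iU; first by rewrite -dU -addSnnS leq_addr.
have iU1 := iso_add_line iU sa aoU.
have dU1 : (\dim (U + <[a]>)%VS + j = d)%N by rewrite dim_add_line // addSnnS.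
have := IH _ iU1 dU1.
set s1 := #|_|; set s := #|_|.
have t := card_sg_notperp sa aoU.
set T := #|_| in t.
have sT : s = (s1 + T)%N.
  rewrite /s /s1 /T -(cardsID [set v : vT | (v : V) \in perp a]); congr (_ + _)%N.
    by apply: eq_card => v; rewrite !inE orth_add_line memv_cap andbA.
  by apply: eq_card => v; rewrite !inE andbC andbA.
have oU1 := dim_orth iU1; rewrite orth_add_line in oU1.
have oU := dim_orth iU.
have h := card_diff (capvSl (orth U) (perp a)).
have DE : #|[set v : vT | ((v : V) \in orth U) && ((v : V) \notin perp a)]| =
  #|[set v : vT | ((v : V) \in orth U) && ((v : V) \notin (orth U :&: perp a)%VS)]|.
  apply: eq_card => v; rewrite !inE memv_cap negb_and.
  by case: ((v : V) \in orth U).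
rewrite DE in t; rewrite sT.
have e1 : \dim (orth U) = (d + m + j).+1 by rewrite dimV in oU; lia.
have e2 : \dim (orth U :&: perp a) = (d + m + j)%N by rewrite dimV in oU1; lia.
rewrite e1 e2 in h.
have h2 : (T * q + E * q ^ (d + j) = E * q ^ (d + j.+1))%N.
  have -> : (E * q ^ (d + j) = c * q ^ (d + m + j))%N.
    by rewrite -mulnA -expnD; congr (_ * _ ^ _)%N; lia.
  have -> : (E * q ^ (d + j.+1) = c * q ^ (d + m + j).+1)%N.
    by rewrite -mulnA -expnD; congr (_ * _ ^ _)%N; lia.
  by rewrite t -mulnDr h.
by move: h2; move: (E * _)%N (E * q ^ (d + j))%N (E * q ^ (d + j.+1))%N (q ^ d.+1)%N; lia.
Qed.

Definition num_gens (j : nat) : nat := \prod_(i < j) (E * q ^ i + 1).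

Lemma num_gensS j : num_gens j.+1 = (num_gens j * (E * q ^ j + 1))%N.
Proof. by rewrite /num_gens big_ord_recr. Qed.

Lemma num_gens_gt0 j : (0 < num_gens j)%N.
Proof. by rewrite /num_gens prodn_gt0 // => i; rewrite addn1. Qed.

(** Induction on the rank j of the residue of U. Pairs (v, G) with U <= G and v in G outside U are
    counted twice: each singular v in U^perp outside U leaves a residue of rank one less, and each G
    has q^d - q^k such vectors. *)
Lemma card_gens j U : iso U -> (\dim U + j = d)%N ->
  #|[set G in gens | (U <= G)%VS]| = num_gens j.
Proof.
elim: j U => [|j IH] U iU dU.
  rewrite addn0 in dU; rewrite /num_gens big_ord0 -(cards1 U).
  apply: eq_card => G; rewrite !inE; apply/andP/eqP => [[/andP [iG /eqP dG] UG]|->].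
    by apply/esym/eqP; rewrite eqEdim UG dG dU /=.
  by rewrite iU dU eqxx subvv.
set N := #|_|; set k := \dim U in dU.
pose T := [set v : vT | [&& sg v, (v : V) \in orth U & (v : V) \notin U]].
have eq1 : (#|T| * num_gens j = N * (q ^ d - q ^ k))%N.
  rewrite -sum_nat_const.
  transitivity (\sum_(v in T) #|[set G in gens | (U + <[v : V]> <= G)%VS]|)%N.
    apply: eq_bigr => v; rewrite inE => /and3P [sv vo vU].
    by rewrite (IH _ (iso_add_line iU sv vo)) // dim_add_line // addSnnS.
  under eq_bigr do rewrite -sum1dep_card.
  rewrite (exchange_big_dep (fun G => (G \in gens) && (U <= G)%VS)) /=; last first.
    by move=> v G _ /andP [-> ]; rewrite add_lineS => /andP [->].
  rewrite /N -sum_nat_const; apply: eq_big => [G|G]; first by rewrite inE.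
  move=> /andP [Gg UG]; have /gensP [iG dG] := Gg.
  rewrite sum1dep_card -dG -(card_diff UG) addnK; apply: eq_card => v.
  rewrite !inE /= add_lineS UG iG dG eqxx /=.
  case vG : (v \in G); rewrite ?andbF ?andbT //=.
  by rewrite (iso_sg iG vG) (subvP (orthS p UG)) // (subvP (iso_orth iG)).
have s := card_sg_orth iU dU.
set S := #|_| in s.
have ST : (S = #|T| + q ^ k)%N.
  rewrite /S /T -(cardsID [set v : vT | (v : V) \in U]) addnC; congr (_ + _)%N.
    by apply: eq_card => v; rewrite !inE andbC andbA.
  rewrite -card_subspace; apply: eq_card => v; rewrite !inE; apply/andb_idl => vU.
  by rewrite (iso_sg iU vU) (subvP (iso_orth iU)).
rewrite num_gensS; apply/eqP.
have kd : (k < d)%N by rewrite -dU; lia.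
have D0 : (0 < q ^ d - q ^ k)%N by rewrite subn_gt0 ltn_exp2l.
rewrite -(eqn_pmul2r D0) -eq1 -(eqn_pmul2r q_gt0); apply/eqP.
have -> : (#|T| * num_gens j * q = num_gens j * (#|T| * q))%N by lia.
suff h : (#|T| * q = (E * q ^ j + 1) * ((q ^ d - q ^ k) * q))%N by rewrite h !mulnA.
have qd : (q ^ d = q ^ k * (q ^ j * q))%N by rewrite -expnSr -expnD dU.
rewrite ST in s.
have e1 : (q ^ (d + j.+1) = q ^ d * (q ^ j * q))%N by rewrite expnD (expnSr _ j).
rewrite e1 expnSr qd in s; rewrite qd.
have : (0 < q ^ j)%N by rewrite expn_gt0 q_gt0.
have : (0 < q ^ k)%N by rewrite expn_gt0 q_gt0.
move: s q_gt0; move: (q) (c * q ^ m)%N (q ^ k)%N (q ^ j)%N #|T|.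
move=> z e x y t s z0 x0 y0.
have : (x <= x * (y * z))%N by rewrite leq_pmulr // muln_gt0 y0.
move=> xle.
(* Writing q^d as q^k + w replaces the truncated difference q^d - q^k by w. *)
have [w wE] : exists w, (x * (y * z) = x + w)%N by exists (x * (y * z) - x)%N; lia.
rewrite wE addKn.
have wE2 : ((x + w) * (y * z) = (x + w) + w * (y * z))%N by rewrite mulnDl wE.
rewrite wE wE2 in s; clear -s; lia.
Qed.


Local Notation qR := (q%:R : R).
Local Notation ER := ((c * #|F| ^ m)%:R : R).
Local Notation K := (ER / qR + 1).
Implicit Types (P : {vspace V}) (L : {set {vspace V}}) (w : vT -> R).

Definition wt w A := \sum_(u : vT | (u : V) \in A) w u.

(** Membership of the characteristic vector in the image of the transposed incidence matrix, with
    the coefficient of a point spread over its nonzero vectors, so that all later counts are counts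
    of vectors. *)
Record degree1 L w : Prop := Degree1 {
  d1_gens : L \subset gens;
  d1_sg : forall u, ~~ sg u -> w u = 0;
  d1_0 : w 0 = 0;
  d1_wt : forall G, G \in gens -> wt w G = (G \in L)%:R
}.

(* For [dim U < d] this is the parameter of the set of elements of [L] through
   [U], seen in the residue of [U] (see [card_through]). *)
Definition par w U := ER * qR ^+ (d - \dim U) / qR * wt w U + wt w (orth U).

Lemma qR_gt1 : 1 < qR.
Proof. by rewrite ltr1n card_field_gt1. Qed.

Lemma qR_gt0 : 0 < qR.
Proof. exact: lt_trans ltr01 qR_gt1. Qed.

Lemma qR_neq0 : qR != 0.
Proof. by rewrite gt_eqF ?qR_gt0. Qed.

Lemma card_diffR A B : (B <= A)%VS ->
  #|[set u : vT | ((u : V) \in A) && ((u : V) \notin B)]|%:R =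
  qR ^+ \dim A - qR ^+ \dim B :> R.
Proof.
by move=> BA; rewrite -!natrX -(card_diff BA) natrD addrK.
Qed.

(** * Double counting identities and inequalities for [par] *)

Section Identity.
Variables (L : {set {vspace V}}) (w : vT -> R).
Hypothesis d1 : degree1 L w.

(* Double counting, for each vector [r], of the [u] with [r \in U + <[u]>] and
   of the [u] with [r] orthogonal to [U + <[u]>]. *)
Lemma par_sum U W : iso W -> (U <= W)%VS -> (\dim U < \dim W)%N ->
  \sum_(u : vT | ((u : V) \in W) && ((u : V) \notin U)) par w (U + <[u : V]>)%VS =
  (qR ^+ \dim W - qR ^+ (\dim W).-1) * par w W +
  (qR ^+ (\dim W).-1 - qR ^+ \dim U) * par w U.
Proof.
move=> iW UW dUW; set n := \dim W; set k := \dim U.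
have dWd : (n <= d)%N by apply: iso_le.
pose D := [set u : vT | ((u : V) \in W) && ((u : V) \notin U)].
transitivity (\sum_(u in D) (ER * qR ^+ (d - k.+1) / qR * wt w (U + <[u : V]>)%VS
    + wt w (orth (U + <[u : V]>)%VS))).
  apply: eq_big => [u|u /andP [uW uU]]; first by rewrite inE.
  by rewrite /par dim_add_line.
rewrite big_split /= -mulr_sumr.
(* A vector r of W outside U lies in U + <u> exactly when u is in U + <r> but not in U; a vector of
   U is counted for every u. *)
have -> : \sum_(u in D) wt w (U + <[u : V]>)%VS =
    (qR ^+ k.+1 - qR ^+ k) * wt w W + (qR ^+ n - qR ^+ k.+1) * wt w U.
  rewrite exchange_weight /wt !mulr_sumr [\sum_(u : vT | (u : V) \in W) _]big_mkcond.
  rewrite [\sum_(u : vT | (u : V) \in U) _]big_mkcond -big_split /=; apply: eq_bigr => r _.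
  case: ifP => rW; last first.
    rewrite ifN; last by apply: contraFN rW => /(subvP UW).
    rewrite addr0 (_ : [set u | _] = set0) ?cards0 ?mul0r //.
    apply/setP => u; rewrite !inE; apply/negbTE/negP => /andP [/andP [uW _]].
    have UuW : (U + <[u : V]> <= W)%VS by rewrite add_lineS UW.
    by move=> /(subvP UuW); rewrite rW.
  case: ifP => rU.
    rewrite -mulrDl addrC addrA subrK; congr (_ * _).
    rewrite -card_diffR //; congr _%:R; apply: eq_card => u; rewrite !inE.
    by rewrite (subvP (addvSl U <[u : V]>)) // andbT.
  have rUn := negbT rU.
  rewrite addr0; congr (_ * _).
  rewrite -(dim_add_line rUn) -card_diffR ?addvSl //; congr _%:R.
  apply: eq_card => u; rewrite !inE.
  case uU : (u \in U); rewrite ?andbF ?andbT //=.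
  rewrite add_line_exchange ?uU //; apply/andb_idl.
  by apply/subvP; rewrite add_lineS UW.
(* A vector r of U^perp is orthogonal to U + <u> exactly when u is in r^perp, which contains W if r
   is in W^perp and otherwise meets W in a hyperplane. *)
have -> : \sum_(u in D) wt w (orth (U + <[u : V]>)%VS) =
    (qR ^+ n - qR ^+ n.-1) * wt w (orth W) + (qR ^+ n.-1 - qR ^+ k) * wt w (orth U).
  have oUW : (orth W <= orth U)%VS by apply: orthS.
  rewrite exchange_weight /wt !mulr_sumr [\sum_(u : vT | (u : V) \in orth W) _]big_mkcond.
  rewrite [\sum_(u : vT | (u : V) \in orth U) _]big_mkcond -big_split /=; apply: eq_bigr => r _.
  have [rU|rU] := boolP ((r : V) \in orth U); last first.
    rewrite ifN; last by apply: contraNN rU; apply/subvP.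
    rewrite addr0 (_ : [set u | _] = set0) ?cards0 ?mul0r //.
    apply/setP => u; rewrite !inE orth_add_line memv_cap (negbTE rU).
    by rewrite /= andbF.
  have DE : #|[set u : vT | (u \in D) && ((r : V) \in orth (U + <[u : V]>)%VS)]|%:R =
      qR ^+ \dim (W :&: perp r) - qR ^+ k :> R.
    rewrite -card_diffR; last by rewrite subv_cap UW -orthE.
    congr _%:R; apply: eq_card => u.
    by rewrite !inE orth_add_line !memv_cap rU /= perpC andbAC.
  rewrite DE dim_cap_perp -orthE; case: ifP => _; last by rewrite add0r.
  by rewrite -mulrDl addrA subrK.
rewrite /par -/n -/k.
have -> : (d - k = (d - n) + (n.-1 - k).+1)%N by lia.
have -> : (d - k.+1 = (d - n) + (n.-1 - k))%N by lia.
have e1 : qR ^+ n = qR * (qR ^+ (n.-1 - k) * qR ^+ k).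
  by rewrite -exprD -exprS; congr (_ ^+ _); lia.
have e2 : qR ^+ n.-1 = qR ^+ (n.-1 - k) * qR ^+ k.
  by rewrite -exprD; congr (_ ^+ _); lia.
rewrite e1 e2 !exprD !exprS; move: qR_neq0 => qn.
by field.
Qed.

(** In the sum of the weights of the generators through U, a vector of U is counted [num_gens j.+1]
    times and a singular vector of U^perp outside U [num_gens j] times. Taking out [num_gens j]
    leaves [par w U]. *)
Lemma card_through j U : iso U -> (\dim U + j.+1 = d)%N ->
  #|[set G in L | (U <= G)%VS]|%:R = (num_gens j)%:R * par w U.
Proof.
move=> iU dU.
have -> : #|[set G in L | (U <= G)%VS]|%:R =
    \sum_(G in [set G in gens | (U <= G)%VS]) wt w G.
  rewrite -sum1_card natr_sum big_mkcond [RHS]big_mkcond /=.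
  apply: eq_bigr => G _; rewrite !inE; have [|GU] := boolP (U <= G)%VS.
    rewrite !andbT => UG; case: ifP => GL.
      have Gg := subsetP (d1_gens d1) _ GL.
      by rewrite inE in Gg; rewrite Gg (d1_wt d1) ?GL // inE.
    case: ifP => // Gg; by rewrite (d1_wt d1) ?GL // inE.
  by rewrite !andbF.
rewrite exchange_weight /par mulrDr /wt !mulr_sumr [\sum_(u : vT | (u : V) \in U) _]big_mkcond.
rewrite [\sum_(u : vT | (u : V) \in orth U) _]big_mkcond -big_split /=; apply: eq_bigr => r _.
have [sr|/(d1_sg d1) ->] := boolP (sg (r : V)); last first.
  by rewrite !mulr0 !if_same addr0.
have [rU|rU] := boolP ((r : V) \in U).
  rewrite (subvP (iso_orth iU)) // mulrA -mulrDl; congr (_ * _).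
  have -> : (d - \dim U = j.+1)%N by lia.
  rewrite -mulrA exprSr mulfK ?qR_neq0 //.
  rewrite -natrX -natrM -{2}[(num_gens j)%:R]mulr1 -mulrDr -(natrD _ _ 1) -natrM.
  rewrite -num_gensS -(card_gens iU dU); congr _%:R.
  apply: eq_card => G; rewrite !inE -andbA; congr (_ && _).
  by apply/andb_idr => UG; apply: (subvP UG).
rewrite add0r; case: ifP => rO.
  congr (_ * _); rewrite -(card_gens (iso_add_line iU sr rO)).
    by congr _%:R; apply: eq_card => G; rewrite !inE -andbA add_lineS.
  by rewrite dim_add_line // addSnnS.
rewrite (_ : [set u | _] = set0) ?cards0 ?mul0r //.
apply/setP => G; rewrite !inE -andbA -add_lineS.
apply/negbTE/negP => /andP [/andP [iG _] UrG].
by case/negP: (negbT rO); case: (iso_add_lineP (isoS UrG iG)).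
Qed.

(** The case dim U = d, outside the range of [card_through]: the singular vectors of G^perp are
    those of G, so both terms of [par] are multiples of the weight of G. *)
Lemma par_gen G : G \in gens -> par w G = K * (G \in L)%:R.
Proof.
move=> Gg; have /gensP [iG dG] := Gg; rewrite /par (d1_wt d1) // dG subnn expr0.
have -> : wt w (orth G) = wt w G.
  rewrite /wt big_mkcond [RHS]big_mkcond /=; apply: eq_bigr => r _.
  have [rG|rG] := boolP ((r : V) \in G); first by rewrite (subvP (iso_orth iG)).
  case: ifP => // rO; rewrite (d1_sg d1) //; apply: contraNN rG => sr.
  exact: (sg_gen_orth Gg).
by rewrite (d1_wt d1) // mulr1 mulrDl mul1r.
Qed.

Lemma E_ge0 : 0 <= ER.
Proof. exact: ler0n. Qed.

Lemma K_ge1 : 1 <= K.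
Proof. by rewrite lerDr divr_ge0 ?E_ge0 // ltW ?qR_gt0. Qed.

Lemma par_ge0 U : iso U -> 0 <= par w U.
Proof.
move=> iU; have := iso_le iU; rewrite leq_eqVlt => /orP [/eqP dU|dU].
  rewrite par_gen; last by apply/gensP.
  by rewrite mulr_ge0 // (le_trans _ K_ge1).
have ng : 0 < (num_gens (d - (\dim U).+1))%:R :> R by rewrite ltr0n num_gens_gt0.
rewrite -(pmulr_rge0 _ ng) -card_through //; lia.
Qed.

Lemma par_neq0 U : iso U -> par w U != 0 -> exists2 G, G \in L & (U <= G)%VS.
Proof.
move=> iU; have := iso_le iU; rewrite leq_eqVlt => /orP [/eqP dU|dU].
  rewrite par_gen; last by apply/gensP.
  by case: (boolP (U \in L)); rewrite ?mulr0 ?eqxx // => UL _; exists U.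
move=> h.
have : #|[set G in L | (U <= G)%VS]|%:R != 0 :> R.
  rewrite (@card_through (d - (\dim U).+1)) ?mulf_neq0 ?pnatr_eq0 -?lt0n ?num_gens_gt0 //.
  by lia.
by rewrite pnatr_eq0 cards_eq0 => /set0Pn [G']; rewrite inE => /andP []; exists G'.
Qed.

Definition full L U := [forall G in gens, (U <= G)%VS ==> (G \in L)].

Lemma fullP U : reflect (forall G, G \in gens -> (U <= G)%VS -> G \in L) (full L U).
Proof.
apply: (iffP forall_inP) => h G Gg; first exact/implyP/h.
by apply/implyP; apply: h.
Qed.

Lemma par_full U : iso U -> full L U -> par w U = ER * qR ^+ (d - \dim U) / qR + 1.
Proof.
move=> iU /fullP fU; have := iso_le iU; rewrite leq_eqVlt => /orP [/eqP dU|dU].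
  have Ug : U \in gens by apply/gensP.
  by rewrite par_gen // fU ?subvv // mulr1 dU subnn expr0 mulr1.
set j := (d - (\dim U).+1)%N.
have dUj : (\dim U + j.+1 = d)%N by rewrite /j; lia.
have ng : (num_gens j)%:R != 0 :> R by rewrite pnatr_eq0 -lt0n num_gens_gt0.
apply: (mulfI ng); rewrite -card_through //.
have -> : (d - \dim U = j.+1)%N by lia.
rewrite exprSr mulrA mulfK ?qR_neq0 // -natrX -natrM -(natrD _ _ 1) -natrM.
rewrite -num_gensS -(card_gens iU dUj); congr _%:R.
apply: eq_card => G; rewrite !inE; apply/andP/andP => [] [GL UG].
  by split=> //; have := subsetP (d1_gens d1) _ GL; rewrite inE.
by split=> //; apply: fU => //; rewrite inE.
Qed.

(* Descending induction on [dim U], using [par_sum] on [U < U + <[a]> + <[b]>]. *)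
Lemma par_le U a : iso (U + <[a]>)%VS -> a \notin U -> ~~ full L (U + <[a]>)%VS ->
  par w (U + <[a]>)%VS <= par w U.
Proof.
have [n] := ubnP (d - \dim U); elim: n U a => // n IH U a dn iW aU.
set W := (U + <[a]>)%VS in iW *; move=> /forallPn [G].
rewrite !negb_imply => /and3P [Gg WG GL].
have /gensP [iG dG] := Gg.
have iU : iso U by apply: isoS iW; apply: addvSl.
have [WeG|WneG] := eqVneq W G.
  by rewrite WeG par_gen // (negbTE GL) mulr0 par_ge0.
have [b bG bW] : exists2 b, b \in G & b \notin W.
  by apply/subvNP; apply: contraNN WneG => GW; rewrite eqEsubv WG.
set W2 := (W + <[b]>)%VS.
have W2G : (W2 <= G)%VS by rewrite add_lineS WG.
have iW2 : iso W2 := isoS W2G iG.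
have dW : \dim W = (\dim U).+1 by rewrite dim_add_line.
have dW2 : \dim W2 = (\dim U).+2 by rewrite dim_add_line // dW.
have dU : ((\dim U).+2 <= d)%N by rewrite -dW2 iso_le.
have UW : (U <= W)%VS by apply: addvSl.
have WW2 : (W <= W2)%VS by apply: addvSl.
have UW2 := subv_trans UW WW2.
have nfull A : (A <= G)%VS -> ~~ full L A.
  by move=> AG; apply/fullP => /(_ G Gg AG); apply/negP.
(* The induction hypothesis bounds [par w W2] by [par w A] for each hyperplane A of W2: as G is not
   in L, its subspace W2 is not full. *)
have step A u : (A + <[u]>)%VS = W2 -> u \notin A -> \dim A = (\dim U).+1 ->
    par w W2 <= par w A.
  move=> AE uA dA; rewrite -AE; apply: IH; rewrite ?AE ?nfull //.
  by rewrite dA; clear -dn dU; lia.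
have dUW2 : (\dim U < \dim W2)%N by rewrite dW2.
(* With k = dim U, the sum has q^(k+1) - q^k terms equal to [par w W] and q^(k+2) - q^(k+1) terms
   that are at least [par w W2]. The multiples of [par w W2] cancel against the right-hand side. *)
have := par_sum iW2 UW2 dUW2; rewrite dW2.
rewrite (bigID (fun u : vT => (u : V) \in W)) /=.
rewrite [X in X + _](eq_bigr (fun=> par w W)); last first.
  move=> u /andP [/andP [uW2 uU] uW]; congr (par w _); apply/eqP.
  by rewrite eqEdim add_lineS UW uW dW dim_add_line /=.
rewrite sum_const_in.
have -> : #|[set u : vT | ((u \in W2) && (u \notin U)) && (u \in W)]|%:R =
    qR ^+ (\dim U).+1 - qR ^+ (\dim U) :> R.
  rewrite -dW -card_diffR //; congr _%:R; apply: eq_card => u; rewrite !inE.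
  by case uW : (u \in W); rewrite ?andbF //= (subvP WW2) // andbT.
have : \sum_(u : vT | ((u : V) \in W2) && ((u : V) \notin U) && ((u : V) \notin W)) par w W2
    <= \sum_(u : vT | ((u : V) \in W2) && ((u : V) \notin U) && ((u : V) \notin W)) par w (U + <[u : V]>)%VS.
  apply: ler_sum => u /andP [/andP [uW2 uU] uW].
  have UuW2 : (U + <[u : V]> <= W2)%VS by rewrite add_lineS UW2.
  have dUu : \dim (U + <[u : V]>)%VS = (\dim U).+1 by rewrite dim_add_line.
  have [b' b'W2 b'U] : exists2 b', b' \in W2 & b' \notin (U + <[u : V]>)%VS.
    by apply: dim_ltNsub; rewrite dUu dW2.
  apply: (step _ b') => //; apply/eqP.
  by rewrite eqEdim add_lineS UuW2 b'W2 dim_add_line // dUu dW2 /=.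
rewrite sum_const_in.
have -> : #|[set u : vT | (((u : V) \in W2) && ((u : V) \notin U)) && ((u : V) \notin W)]|%:R =
    qR ^+ (\dim U).+2 - qR ^+ (\dim U).+1 :> R.
  rewrite -dW2 -dW -card_diffR //; congr _%:R; apply: eq_card => u; rewrite !inE.
  case uW : (u \in W); rewrite ?andbF //= !andbT; apply/andb_idr => _.
  by apply: contraFN uW; apply/subvP.
set S := \sum_(_ | _) _; rewrite !exprS; set x := qR ^+ _.
have x_gt0 : 0 < x by rewrite exprn_gt0 ?qR_gt0.
have q1 := qR_gt1; move: q1 x_gt0; move: (qR) => z.
move=> z1 x0 h1 h2.
have : 0 <= (z * x - x) * (par w U - par w W) by lra.
by rewrite pmulr_rge0 ?subr_ge0 // -{2}[x]mul1r -mulrBl mulr_gt0 // subr_gt0.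
Qed.

End Identity.

Hypothesis c_gt0 : (0 < c)%N.
Hypothesis d_gt0 : (0 < d)%N.

Lemma E_gt0 : 0 < ER.
Proof. by rewrite ltr0n muln_gt0 c_gt0 expn_gt0 (ltnW (card_field_gt1 F)). Qed.

Lemma gen_through U : iso U -> exists2 G, G \in gens & (U <= G)%VS.
Proof.
move=> iU; have dU := subnKC (iso_le iU).
have : (0 < #|[set G in gens | (U <= G)%VS]|)%N.
  by rewrite (card_gens iU dU) num_gens_gt0.
by move=> /card_gt0P [G]; rewrite inE => /andP []; exists G.
Qed.

Lemma dim1_line P : \dim P = 1%N -> exists2 u, u != 0 & P = <[u]>%VS.
Proof.
move=> dP; exists (vpick P); first by rewrite vpick0 -dimv_eq0 dP.
have u0 : vpick P != 0 by rewrite vpick0 -dimv_eq0 dP.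
by apply/esym/eqP; rewrite eqEdim subv_line memv_pick dim_vline u0 dP.
Qed.

Lemma card_CL L w : degree1 L w -> #|L|%:R = (num_gens d.-1)%:R * par w 0.
Proof.
move=> d1; rewrite -(card_through d1 (iso0 p)); last first.
  by rewrite dimv0 prednK.
by congr _%:R; apply: eq_card => G; rewrite !inE sub0v andbT.
Qed.

(** * Removing the pencil of a full point *)

Section Remove.
Variables (L : {set {vspace V}}) (w : vT -> R) (u0 : V).
Hypotheses (d1 : degree1 L w) (su0 : sg u0) (u0n : u0 != 0)
  (fu0 : full L <[u0]>).

Definition remove_pencil : {set {vspace V}} := [set G in L | u0 \notin G].

(** The point <u0> has q - 1 nonzero vectors, so this lowers by 1 the weight of the subspaces
    containing u0 and changes no other weight. *)
Definition remove_weight : vT -> R :=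
  fun u => w u - (((u : V) \in <[u0]>%VS) && (u != 0))%:R / (qR - 1).

Lemma wt_remove A : wt remove_weight A = wt w A - (u0 \in A)%:R.
Proof.
rewrite /wt sumrB; congr (_ - _); rewrite -mulr_suml -natr_sum.
have q1 : qR - 1 != 0 by rewrite subr_eq0 gt_eqF ?qR_gt1.
case: (boolP (u0 \in A)) => uA; last first.
  rewrite big1 ?mul0r // => u uA'; apply/eqP; rewrite eqb0.
  apply: contraNN uA => /andP [/vlineP [k uk] un].
  have k0 : k != 0 by apply: contraNneq un => k0; rewrite uk k0 scale0r.
  by rewrite -(scalerK k0 u0) -uk memvZ.
have uu0A u : u \in <[u0]>%VS -> u \in A by apply/subvP; rewrite subv_line.
apply: (mulIf q1); rewrite divfK // mul1r.
have -> : qR - 1 = qR ^+ \dim <[u0]> - qR ^+ \dim (0%VS : {vspace V}).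
  by rewrite dim_vline u0n dimv0 expr1 expr0.
rewrite -(card_diffR (sub0v _)) -sum1dep_card big_mkcond [in RHS]big_mkcond /=.
congr _%:R; apply: eq_bigr => u _; rewrite memv0.
case: (boolP ((u : V) \in <[u0]>%VS)) => [uu0|_] /=; last by rewrite if_same.
by rewrite uu0A //; case: eqP.
Qed.

Lemma remove_full G : G \in gens -> u0 \in G -> G \in L.
Proof. by move=> Gg uG; apply: (fullP _ _ fu0) => //; rewrite subv_line. Qed.

Lemma degree1_remove : degree1 remove_pencil remove_weight.
Proof.
split=> [|u su||G Gg].
- by apply/subsetP => G; rewrite inE => /andP [/(subsetP (d1_gens d1))].
- rewrite /remove_weight (d1_sg d1 su) sub0r; case: (boolP (_ \in _)) => /= [|_].
    by move=> /vlineP [k uk]; case/negP: su; rewrite uk sgZ.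
  by rewrite mul0r oppr0.
- by rewrite /remove_weight (d1_0 d1) eqxx andbF mul0r subrr.
- rewrite wt_remove (d1_wt d1 Gg) inE; case: (boolP (u0 \in G)) => uG /=.
    by rewrite remove_full // andbF subrr.
  by rewrite andbT subr0.
Qed.

Lemma par_remove U : par remove_weight U =
  par w U - ER * qR ^+ (d - \dim U) / qR * (u0 \in U)%:R - (u0 \in orth U)%:R.
Proof. by rewrite /par !wt_remove; ring. Qed.

Lemma par_remove0 : par remove_weight 0 = par w 0 - 1.
Proof.
by rewrite par_remove memv0 (negbTE u0n) mulr0 subr0 orth0 memvf.
Qed.

End Remove.

(** * Full points when x is at most E/q + 1 *)

Section Main.
Variables (L : {set {vspace V}}) (w : vT -> R).
Hypothesis d1 : degree1 L w.
Hypothesis par_leK : par w 0 <= K.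

(** Suppose the two points are collinear and remove the pencil of u0. A generator through both is
    lost, so u1 is no longer full and [par_le] bounds its new parameter E q^(d-1) / q by x - 1 <=
    E/q. This is absurd, since the line through the points forces d >= 2. *)
Lemma full_noncollinear u0 u1 : sg u0 -> u0 != 0 -> full L <[u0]> ->
  sg u1 -> u1 \notin <[u0]>%VS -> full L <[u1]> -> u1 \notin perp u0.
Proof.
move=> s0 n0 f0 s1 n1 f1; apply/negP => u10.
have u1n : u1 != 0 by apply: contraNneq n1 => ->; rewrite mem0v.
have o1 : u1 \in orth <[u0]> by rewrite orthE subv_line perpC.
have iW := iso_add_line (iso_line s0) s1 o1.
have dW := iso_le iW; rewrite dim_add_line // dim_vline n0 in dW.
have d1' := degree1_remove d1 s0 n0 f0.
have [G Gg WG] := gen_through iW.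
have [u0G u1G] : u0 \in G /\ u1 \in G.
  move: WG; rewrite add_lineS subv_line => /andP [] //.
have := par_le d1' (U := 0%VS) (a := u1).
rewrite add0v memv0 u1n => /(_ (iso_line s1) isT).
have -> : ~~ full (remove_pencil L u0) <[u1]>.
  by apply/fullP => /(_ G Gg); rewrite subv_line u1G inE u0G andbF => /(_ isT).
move=> /(_ isT); rewrite par_remove0 // par_remove //.
have -> : (u0 \in <[u1]>%VS) = false.
  apply: contraNF n1 => /vlineP [k uk]; have k0 : k != 0.
    by apply: contraNneq n0 => k0; rewrite uk k0 scale0r.
  by rewrite -(scalerK k0 u1) -uk memvZ ?memv_line.
rewrite orthE subv_line u10 (par_full d1 (iso_line s1) f1).
rewrite dim_vline u1n.
have : ER / qR < ER * qR ^+ (d - 1) / qR.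
  by rewrite ltr_pM2r ?invr_gt0 ?qR_gt0 // ltr_pMr ?E_gt0 // exprn_egt1 ?qR_gt1 // subn_eq0 -ltnNge.
rewrite mulr0 subr0 addrK => h1 h2; have := lt_le_trans h1 h2.
by rewrite ltrBrDr ltNge par_leK.
Qed.

Lemma par_line_le u : sg u -> u != 0 -> ~~ full L <[u]> -> par w <[u]> <= par w 0.
Proof.
move=> su un fu; have := par_le d1 (U := 0%VS) (a := u).
by rewrite add0v memv0 un; apply=> //; apply: iso_line.
Qed.

Lemma sum_par_line G : G \in gens ->
  \sum_(u : vT | ((u : V) \in G) && (u != 0)) par w <[u : V]> =
  (qR ^+ d - qR ^+ d.-1) * (K * (G \in L)%:R) + (qR ^+ d.-1 - 1) * par w 0.
Proof.
move=> Gg; have /gensP [iG dG] := Gg.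
have := par_sum w iG (sub0v G); rewrite dimv0 dG => /(_ d_gt0).
rewrite (par_gen d1 Gg) expr0 => <-; apply: eq_big => [u|u _].
  by rewrite memv0.
by rewrite add0v.
Qed.

(** All points of G have parameter at most x. Inserting this into [sum_par_line] gives x >= K; with
    x <= K every inequality used is an equality. *)
Lemma no_full_par G : G \in L ->
    (forall u, u \in G -> u != 0 -> ~~ full L <[u]>) ->
  par w 0 = K /\ forall u, u \in G -> u != 0 -> par w <[u]> = K.
Proof.
move=> GL nf; have Gg := subsetP (d1_gens d1) _ GL; have /gensP [iG dG] := Gg.
have := sum_par_line Gg; rewrite GL mulr1 => sumE.
have le u : u \in G -> u != 0 -> par w <[u]> <= par w 0.
  by move=> uG un; apply: par_line_le => //; [exact: iso_sg iG uG | exact: nf].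
have cardE : \sum_(u : vT | ((u : V) \in G) && (u != 0)) par w 0 = (qR ^+ d - 1) * par w 0.
  rewrite sum_const_in; congr (_ * _).
  have -> : qR ^+ d - 1 = qR ^+ \dim G - qR ^+ \dim (0%VS : {vspace V}).
    by rewrite dG dimv0 expr0.
  rewrite -card_diffR ?sub0v //.
  by congr _%:R; apply: eq_card => u; rewrite !inE memv0.
have lesum : (qR ^+ d - qR ^+ d.-1) * K + (qR ^+ d.-1 - 1) * par w 0 <= (qR ^+ d - 1) * par w 0.
  by rewrite -sumE -cardE; apply: ler_sum => u /andP [uG un]; apply: le.
have dpos : 0 < qR ^+ d - qR ^+ d.-1 by rewrite subr_gt0 ltr_eXn2l ?prednK ?qR_gt1.
have xK : par w 0 = K.
  apply/eqP; rewrite eq_le par_leK /= -subr_ge0 -(pmulr_rge0 _ dpos).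
  by move: lesum; lra.
split=> // u uG un; apply/eqP; rewrite eq_sym -subr_eq0.
have /eqP : \sum_(u : vT | ((u : V) \in G) && (u != 0)) (par w 0 - par w <[u : V]>) = 0.
  by rewrite sumrB cardE sumE xK; ring.
rewrite psumr_eq0 => [|v /andP [vG vn]]; last by rewrite subr_ge0 le.
by move=> /allP /(_ (u : vT)); rewrite mem_index_enum uG un xK; apply.
Qed.

End Main.

(** Removing a full pencil keeps G0 and creates no full point on it, so [no_full_par] would apply to
    both x and x - 1 and make each of them equal to K. *)
Lemma no_full_all L w G0 : degree1 L w -> par w 0 <= K -> G0 \in L ->
    (forall u, u \in G0 -> u != 0 -> ~~ full L <[u]>) ->
  forall u, sg u -> u != 0 -> ~~ full L <[u]>.
Proof.
move=> d1 le GL nf u su un; apply/negP => fu.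
have d1' := degree1_remove d1 su un fu.
have le' : par (remove_weight w u) 0 <= K by rewrite par_remove0 //; lra.
have GL' : G0 \in remove_pencil L u.
  by rewrite inE GL; apply/negP => /nf; rewrite un fu => /(_ isT).
have [|e _] := no_full_par d1' le' GL'; last by rewrite par_remove0 // in e; lra.
move=> v vG vn; apply: contraNN (nf v vG vn) => /fullP h; apply/fullP => G Gg vG'.
by have := h G Gg vG'; rewrite inE => /andP [].
Qed.

Lemma degree1_small L w : degree1 L w -> par w 0 <= K ->
  (exists S : {set {vspace V}},
    [/\ #|S|%:R = par w 0, forall P, P \in S -> iso P /\ \dim P = 1%N,
      {in S &, forall P P', P != P' -> ~~ iso (P + P')%VS}
      & L = [set G in gens | [exists P in S, (P <= G)%VS]]]) \/
  [/\ par w 0 = K, L != set0, forall u, sg u -> u != 0 -> ~~ full L <[u]>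
    & forall G u, G \in L -> u \in G -> u != 0 -> par w <[u]> = K].
Proof.
move=> d1 le.
pose hasfull G := [exists u : vT, [&& (u : V) \in G, u != 0 & full L <[u : V]>%VS ]].
have [/exists_inP [G0 G0L nf]|allf] := boolP [exists G in L, ~~ hasfull G]; [right|left].
  have nf0 u : u \in G0 -> u != 0 -> ~~ full L <[u]>.
    move=> uG un; apply: contraNN nf => fu; apply/existsP; exists u.
    by rewrite uG un.
  have nfa := no_full_all d1 le G0L nf0.
  have [xK _] := no_full_par d1 le G0L nf0.
  split=> //; first by apply/set0Pn; exists G0.
  move=> G u GL uG un; have /gensP [iG _] := subsetP (d1_gens d1) _ GL.
  have [_] := no_full_par d1 le GL (fun v vG => nfa v (iso_sg iG vG)).
  by apply.
(* All full points. They are pairwise non-collinear by [full_noncollinear], so every element of L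
   contains exactly one of them. *)
pose S := [set P : {vspace V} | [&& iso P, \dim P == 1%N & full L P]].
have SP P : P \in S -> exists u, [/\ sg u, u != 0, P = <[u]>%VS & full L P].
  rewrite inE => /and3P [iP /eqP dP fP]; have [u un PE] := dim1_line dP.
  by exists u; split=> //; apply: (iso_sg iP); rewrite PE memv_line.
have nc : {in S &, forall P P', P != P' -> ~~ iso (P + P')%VS}.
  move=> P P' /SP [u [su un PE fP]] /SP [u' [su' un' PE' fP']] PP'.
  rewrite PE PE' in fP fP' PP' *.
  have : u' \notin perp u.
    apply: (full_noncollinear d1 le) => //; apply: contraNN PP' => u'u.
    by rewrite eq_sym eqEdim subv_line u'u !dim_vline un un'.
  apply: contraNN => i; apply: (iso_perp i).
    by rewrite (subvP (addvSl _ _)) ?memv_line.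
  by rewrite (subvP (addvSr _ _)) ?memv_line.
have ex G : G \in L -> exists2 P, P \in S & (P <= G)%VS.
  move=> GL; have /gensP [iG _] := subsetP (d1_gens d1) _ GL.
  move: allf; rewrite negb_exists => /forallP /(_ G); rewrite GL /= negbK.
  move=> /existsP [u /and3P [uG un fu]]; exists <[u : V]>%VS; last by rewrite subv_line.
  by rewrite inE dim_vline un fu (iso_line (iso_sg iG uG)).
exists S; split=> //; last 2 first.
- by move=> P; rewrite inE => /and3P [iP /eqP dP _].
- apply/setP => G; rewrite inE; apply/idP/andP => [GL|[Gg /exists_inP [P PS PG]]].
    split; first exact: subsetP (d1_gens d1) _ GL.
    by have [P PS PG] := ex _ GL; apply/exists_inP; exists P.
  by have [u [_ _ _ /fullP]] := SP _ PS; apply.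
have ng : (num_gens d.-1)%:R != 0 :> R by rewrite pnatr_eq0 -lt0n num_gens_gt0.
(* The size of L is |S| times the size of a pencil; [card_CL] turns this into |S| = x. *)
apply: (mulfI ng); rewrite -(card_CL d1) -natrM mulnC -sum_nat_const; congr _%:R.
transitivity (\sum_(P in S) #|[set G in gens | (P <= G)%VS]|)%N.
  apply: eq_bigr => P; rewrite inE => /and3P [iP /eqP dP _].
  by rewrite (@card_gens d.-1) // dP add1n prednK.
under eq_bigr do rewrite -sum1dep_card.
rewrite (exchange_big_dep (mem L)) /=; last first.
  by move=> P G /SP [u [_ _ _ /fullP fP]] /andP [Gg PG]; apply: fP.
rewrite -sum1_card; apply: eq_bigr => G GL; have [P PS PG] := ex _ GL.
have Gg := subsetP (d1_gens d1) _ GL; have /gensP [iG _] := Gg.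
rewrite (big_pred1 P) // => P'; rewrite Gg /=; apply/andP/eqP => [[P'S P'G]|-> //].
apply/eqP; apply: contraT => /(nc _ _ P'S PS) /negP []; apply: isoS iG.
by rewrite subv_add P'G.
Qed.

End Counting.

(** * Covered vectors *)

Section Covered.
Variables (F : finFieldType) (V : vectType F) (c : nat) (p : polarity V c).
Variables (d m : nat) (R : realFieldType).
Local Notation vT := (finvect_type V).
Local Notation q := #|F|.
Local Notation sg := (sg p).
Local Notation perp := (perp p).
Local Notation orth := (orth p).
Local Notation iso := (iso p).
Local Notation qR := (q%:R : R).
Local Notation ER := ((c * #|F| ^ m)%:R : R).
Local Notation K := (ER / qR + 1).
Local Notation gens := (gens p d).
Local Notation full := (full p d).
Implicit Types (A B U W G H P : {vspace V}) (u v : V).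

Definition covered (L : {set {vspace V}}) (u : V) := [exists G in L, u \in G].

Lemma coveredP (L : {set {vspace V}}) u : reflect (exists2 G, G \in L & u \in G) (covered L u).
Proof. exact: exists_inP. Qed.

Lemma cov_mem (L : {set {vspace V}}) G u : G \in L -> u \in G -> covered L u.
Proof. by move=> GL uG; apply/coveredP; exists G. Qed.

Lemma covZ (L : {set {vspace V}}) a u : covered L u -> covered L (a *: u).
Proof. by move=> /coveredP [G GL uG]; apply: (cov_mem GL); rewrite memvZ. Qed.

Lemma covered_sg (L : {set {vspace V}}) u : L \subset gens -> covered L u -> sg u.
Proof.
move=> Lg /coveredP [G /(subsetP Lg) /gensP [iG _]]; exact: iso_sg.
Qed.

(* The combinatorial properties of the set of generators of an embedded polar
   space; [k] stands for [q^(e-1) + 1]. *)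
Record subpolar (L : {set {vspace V}}) (k : nat) : Prop := Subpolar {
  sp_gens : L \subset gens;
  sp_neq0 : L != set0;
  sp_k : (1 < k)%N;
  sp_d : (1 < d)%N;
  sp_covD : forall u v, covered L u -> covered L v -> v \in perp u ->
    covered L (u + v);
  sp_gen : forall G, G \in gens -> (forall u, u \in G -> covered L u) -> G \in L;
  sp_hyp : forall H, iso H -> (\dim H).+1 = d -> (forall u, u \in H -> covered L u) ->
    #|[set G in L | (H <= G)%VS]| = k;
  sp_full : forall u, sg u -> u != 0 -> ~~ full L <[u]>
}.

(** * From weights to covered vectors in the absence of full points *)

Section FromWeights.
Hypothesis iso_le : forall U, iso U -> (\dim U <= d)%N.
Hypothesis iso_ex : exists2 G, iso G & \dim G = d.
Hypothesis dimV : \dim {:V} = (2 * d + m)%N.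
Hypothesis c_gt0 : (0 < c)%N.
Hypothesis d_gt0 : (0 < d)%N.
Variables (L : {set {vspace V}}) (w : vT -> R).
Hypothesis d1 : degree1 p d L w.
Local Notation par := (par p d m).
Hypothesis par0K : par w 0 = K.
Hypothesis L_neq0 : L != set0.
Hypothesis nfull : forall u, sg u -> u != 0 -> ~~ full L <[u]>.
Hypothesis parK : forall G u, G \in L -> u \in G -> u != 0 -> par w <[u]> = K.

Let LG G : G \in L -> G \in gens.
Proof. exact: subsetP (d1_gens d1) G. Qed.

Lemma K_gt1 : 1 < K.
Proof. by rewrite ltrDr divr_gt0 ?E_gt0 ?qR_gt0. Qed.

(** Every point of U has parameter K and x = K, so with n = dim U the identity [par_sum] for 0 < U
    reads (q^n - 1) K = (q^n - q^(n-1)) x_U + (q^(n-1) - 1) K. *)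
Lemma par_covered U : iso U -> U != 0%VS -> (forall u, u \in U -> covered L u) ->
  par w U = K.
Proof.
move=> iU Un cU; have dU : (0 < \dim U)%N by rewrite lt0n dimv_eq0.
have := par_sum iso_le dimV w iU (sub0v U); rewrite dimv0 => /(_ dU).
rewrite (eq_bigr (fun=> K)); last first.
  move=> u /andP [uU u0]; rewrite add0v; have /coveredP [G GL uG] := cU _ uU.
  by apply: parK GL uG _; rewrite memv0 in u0.
rewrite sum_const_in card_diffR ?sub0v // dimv0 expr0 par0K => e.
have qq : qR ^+ \dim U - qR ^+ (\dim U).-1 != 0.
  by rewrite subr_eq0 gt_eqF // ltr_eXn2l ?prednK ?qR_gt1.
by apply: (mulfI qq); move: e; lra.
Qed.

(** If no element of L contained the plane W spanned by u and v, its parameter would be 0 and the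
    parameters of its nonzero vectors would add up to (q - 1) K. The multiples of u alone contribute
    that much, while v contributes K > 0 more. *)
Lemma coveredD u v : covered L u -> covered L v -> v \in perp u -> covered L (u + v).
Proof.
move=> cu cv vu; have [vl|vl] := boolP (v \in <[u]>%VS).
  have : u + v \in <[u]>%VS by rewrite memvD ?memv_line.
  by move=> /vlineP [a ->]; apply: covZ.
have [u0|un] := eqVneq u 0; first by rewrite u0 add0r.
have vn : v != 0 by apply: contraNneq vl => ->; rewrite mem0v.
have o1 : v \in orth <[u]> by rewrite orthE subv_line perpC.
have iW := iso_add_line (iso_line (covered_sg (d1_gens d1) cu)) (covered_sg (d1_gens d1) cv) o1.
set W := (<[u]> + <[v]>)%VS in iW.
have uW : (<[u]> <= W)%VS := addvSl _ _.
have dW : \dim W = 2%N by rewrite dim_add_line // dim_vline un.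
suff /(par_neq0 iso_le iso_ex dimV d1 iW) [G GL WG] : par w W != 0.
  apply/coveredP; exists G => //; move: WG; rewrite add_lineS subv_line => /andP [uG vG].
  exact: memvD.
apply/negP => /eqP pW0.
have dW0 : (\dim (0%VS : {vspace V}) < \dim W)%N by rewrite dimv0 dW.
have := par_sum iso_le dimV w iW (sub0v W) dW0; rewrite pW0 mulr0 add0r dimv0 dW par0K.
rewrite (bigID (fun t : vT => (t : V) \in <[u]>%VS)) /=.
rewrite [X in X + _](eq_bigr (fun=> K)); last first.
  move=> t /andP [/andP [_]]; rewrite memv0 add0v => tn tu.
  move: tu tn => /vlineP [a ->] an; have /coveredP [G GL aG] := covZ a cu.
  exact: parK GL aG an.
rewrite sum_const_in.
have -> : #|[set t : vT | (((t : V) \in W) && ((t : V) \notin 0%VS)) && ((t : V) \in <[u]>%VS)]|%:R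
    = qR ^+ 1 - qR ^+ 0.
  have -> : qR ^+ 1 - qR ^+ 0 = qR ^+ \dim <[u]> - qR ^+ \dim (0%VS : {vspace V}).
    by rewrite dim_vline un dimv0.
  rewrite -card_diffR ?sub0v //; congr _%:R; apply: eq_card => t; rewrite !inE.
  rewrite andbC; case tu : (_ \in <[u]>%VS); rewrite ?andbF //=.
  by rewrite (subvP uW).
rewrite -[RHS]addr0 => /addrI /eqP.
rewrite psumr_eq0; last first.
  move=> t /andP [/andP [tW _] _]; apply: (par_ge0 iso_le iso_ex dimV d1); rewrite add0v.
  by apply: isoS iW; rewrite subv_line.
move=> /allP /(_ (v : vT)); rewrite mem_index_enum => /(_ isT).
have vW : v \in W by rewrite (subvP (addvSr _ _)) ?memv_line.
rewrite vW memv0 vn vl add0v /=; have /coveredP [G GL vG] := cv.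
by rewrite (parK GL vG vn) gt_eqF // (lt_trans ltr01 K_gt1).
Qed.

Lemma subpolar_weights : exists2 k : nat, k%:R = K & subpolar L k.
Proof.
have /set0Pn [G0 G0L] := L_neq0; have /gensP [iG0 dG0] := LG G0L.
have cov G u : G \in L -> u \in G -> covered L u.
  by move=> GL uG; apply/coveredP; exists G.
(* In rank 1 the only generator through a point is the point itself, so a point in L would be
   full. *)
have d_gt1 : (1 < d)%N.
  rewrite ltn_neqAle d_gt0 andbT eq_sym; apply/eqP => d1'.
  have [u un uE] : exists2 u, u != 0 & G0 = <[u]>%VS by apply: dim1_line; rewrite dG0.
  have su : sg u by apply: (iso_sg iG0); rewrite uE memv_line.
  case/fullP: (nfull su un) => G /gensP [iG dG] uG.
  suff -> : G = G0 by [].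
  by rewrite uE; apply/esym/eqP; rewrite eqEdim uG dG d1' dim_vline un.
(* The residue of H has rank 1 and [num_gens] is 1 at 0, so the count is the parameter of H; H is
   nonzero because d > 1. *)
have hyp H : iso H -> (\dim H).+1 = d -> (forall u, u \in H -> covered L u) ->
    #|[set G in L | (H <= G)%VS]|%:R = K.
  move=> iH dH cH; rewrite (@card_through _ _ _ _ _ _ _ iso_le iso_ex dimV _ _ d1 0) ?addn1 //.
  rewrite par_covered //; first by rewrite /num_gens big_ord0 mul1r.
  by rewrite -dimv_eq0 -lt0n; move: d_gt1; rewrite -dH.
have [u uG un] : exists2 u, u \in G0 & u != 0.
  by exists (vpick G0); rewrite ?memv_pick // vpick0 -dimv_eq0 dG0 -lt0n.
pose H0 := (G0 :\: <[u]>)%VS.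
have H0G : (H0 <= G0)%VS := diffvSl _ _.
have dH0 : (\dim H0).+1 = d.
  have := dimv_cap_compl G0 <[u]>; rewrite (capv_idPr _) ?subv_line //.
  by rewrite dim_vline un dG0 add1n.
have k0 := hyp H0 (isoS H0G iG0) dH0 (fun v vH => cov _ _ G0L (subvP H0G _ vH)).
exists #|[set G in L | (H0 <= G)%VS]| => //; split=> //.
- exact: d1_gens d1.
- by rewrite -(ltr1n R) k0 K_gt1.
- exact: coveredD.
- move=> G Gg cG; have /gensP [iG dG] := Gg; apply: contraT => GL.
  have : par w G = K by apply: par_covered => //; rewrite -dimv_eq0 dG -lt0n.
  rewrite (par_gen m iso_le d1 Gg) (negbTE GL) mulr0 => /eqP.
  by rewrite eq_sym gt_eqF // (lt_trans ltr01 K_gt1).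
- by move=> H iH dH cH; apply/eqP; rewrite -(eqr_nat R) k0 hyp.
Qed.

End FromWeights.

Section Subpolar.
Variables (L : {set {vspace V}}) (k : nat).
Hypothesis iso_le : forall U, iso U -> (\dim U <= d)%N.
Hypothesis sp : subpolar L k.
Local Notation cov := (covered L).

Lemma sp_iso G : G \in L -> iso G.
Proof. by move=> /(subsetP (sp_gens sp)) /gensP []. Qed.

Lemma sp_dim G : G \in L -> \dim G = d.
Proof. by move=> /(subsetP (sp_gens sp)) /gensP []. Qed.

Lemma cov_sg u : cov u -> sg u.
Proof. exact: covered_sg (sp_gens sp). Qed.

Lemma covN u : cov u -> cov (- u).
Proof. by rewrite -scaleN1r; apply: covZ. Qed.

Lemma covB u v : cov u -> cov v -> v \in perp u -> cov (u - v).
Proof. by move=> cu cv vu; apply: (sp_covD sp) => //; [exact: covN | rewrite memvN]. Qed.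

Lemma gen_perp G u : G \in L -> sg u -> (G <= perp u)%VS -> u \in G.
Proof.
move=> GL su Gu; apply: (sg_gen_orth iso_le) => //; last by rewrite orthE.
exact: subsetP (sp_gens sp) _ GL.
Qed.

Lemma gen_Nperp G u : G \in L -> sg u -> u \notin G ->
  exists2 v, v \in G & v \notin perp u.
Proof.
by move=> GL su uG; apply/subvNP; apply: contraNN uG; apply: gen_perp.
Qed.

(** Take G2 meeting G1 in the smallest dimension. If u != 0 lies in both, replace G2 by another
    element G3 of L through a complement H of u in G2. A vector common to G1 and G3 is orthogonal to
    H and u, hence lies in G2; so the intersection shrinks and loses u. *)
Lemma ex_opposite : exists G1 G2, [/\ G1 \in L, G2 \in L & (G1 :&: G2 = 0)%VS].
Proof.
have /set0Pn [G1 G1L] := sp_neq0 sp.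
case: (arg_minnP (fun G => \dim (G1 :&: G)) G1L) => G2 G2L0 minG2; have G2L : G2 \in L by [].
exists G1, G2; split=> //; apply/eqP; rewrite -dimv_eq0; apply: contraT => dn.
have u12 := memv_pick (G1 :&: G2); set u := vpick _ in u12.
have un : u != 0 by rewrite vpick0 -dimv_eq0.
move: u12; rewrite memv_cap => /andP [uG1 uG2].
pose H := (G2 :\: <[u]>)%VS.
have HG : (H <= G2)%VS := diffvSl _ _.
have dH : (\dim H).+1 = d.
  have := dimv_cap_compl G2 <[u]>; rewrite (capv_idPr _) ?subv_line //.
  by rewrite dim_vline un (sp_dim G2L) add1n.
have uH : u \notin H.
  apply: contraNN un => uH; rewrite -memv0 -(capv_diff G2 <[u]>) memv_cap uH.
  by rewrite memv_line.
have HuE : (H + <[u]>)%VS = G2.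
  by apply/eqP; rewrite eqEdim add_lineS HG uG2 dim_add_line // (sp_dim G2L) dH /=.
have cardH := sp_hyp sp (isoS HG (sp_iso G2L)) dH (fun v vH => cov_mem G2L (subvP HG _ vH)).
have [G3 [G3L HG3 G32]] : exists G3, [/\ G3 \in L, (H <= G3)%VS & G3 != G2].
  have : (0 < #|[set G in L | (H <= G)%VS] :\ G2|)%N.
    have := cardsD1 G2 [set G in L | (H <= G)%VS].
    by rewrite inE G2L HG cardH => e; move: (sp_k sp); rewrite e.
  by move=> /card_gt0P [G3]; rewrite !inE => /and3P [? ? ?]; exists G3.
have uG3 : u \notin G3.
  apply: contraNN G32 => uG3; rewrite eq_sym eqEdim -{1}HuE add_lineS HG3 uG3.
  by rewrite !sp_dim /=.
have sub : (G1 :&: G3 <= G1 :&: G2)%VS.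
  apply/subvP => t; rewrite !memv_cap => /andP [tG1 tG3]; rewrite tG1 /=.
  apply: gen_perp => //; first exact: iso_sg (sp_iso G1L) tG1.
  rewrite -HuE add_lineS; apply/andP; split.
    by apply/subvP => h hH; apply: (iso_perp (sp_iso G3L)) => //; apply: (subvP HG3).
  exact: (iso_perp (sp_iso G1L)).
have := minG2 G3 G3L; rewrite leqNgt => /negP []; rewrite ltn_neqAle dimvS // andbT.
apply/negP => /eqP e; case/negP: uG3.
have e3 : (G1 :&: G3)%VS = (G1 :&: G2)%VS by apply/eqP; rewrite eqEdim sub e /=.
have : u \in (G1 :&: G3)%VS by rewrite e3 memv_cap uG1.
by rewrite memv_cap => /andP [].
Qed.

Definition saturated W := forall u, u \in W -> sg u -> cov u.

(* Otherwise a covered point outside the hyperplane [W] would be full: each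
   generator through it is spanned by it and its intersection with [W]. *)
Lemma saturated_hyperplane W : saturated W -> (\dim W).+1 = \dim {:V} ->
  forall u, cov u -> u \in W.
Proof.
move=> sW dW u cu; apply: contraT => uW.
have un : u != 0 by apply: contraNneq uW => ->; rewrite mem0v.
have VE : (W + <[u]>)%VS = fullv.
  by apply/eqP; rewrite eqEdim subvf dim_add_line // dW /=.
case/fullP: (sp_full sp (cov_sg cu) un) => G Gg; rewrite subv_line => uG.
have /gensP [iG dG] := Gg.
apply: (sp_gen sp) => // g gG; have : g \in (W + <[u]>)%VS by rewrite VE memvf.
move=> /mem_add_line [a gaW]; rewrite -(subrK (a *: u) g).
have gaG : g - a *: u \in G by rewrite memvB ?memvZ.
apply: (sp_covD sp).
- by apply: sW => //; apply: iso_sg iG gaG.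
- exact: covZ.
- by apply: (iso_perp iG) => //; rewrite memvZ.
Qed.

(** If every singular vector were covered, every generator would be in L and every point full. *)
Lemma saturated_neqT : ~ saturated fullv.
Proof.
move=> s; have /set0Pn [G GL] := sp_neq0 sp.
have un : vpick G != 0 by rewrite vpick0 -dimv_eq0 (sp_dim GL) -lt0n (ltn_trans _ (sp_d sp)).
have su := iso_sg (sp_iso GL) (memv_pick G).
case/fullP: (sp_full sp su un) => G' Gg _; have /gensP [iG _] := Gg.
by apply: (sp_gen sp) => // u uG; apply: s; [rewrite memvf | apply: iso_sg iG uG].
Qed.

End Subpolar.
End Covered.

(** * Quadratic, Hermitian and symplectic forms *)

Section Trace.
Variables (F : finFieldType) (theta : {rmorphism F -> F}).
Hypothesis thetaK : involutive theta.
Hypothesis theta_neq : ~ theta =1 id.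

Definition fixF := [set a : F | theta a == a].

Lemma theta_moved : exists a, theta a != a.
Proof.
apply: contrapT => h; apply: theta_neq => a; apply/eqP; apply: contraT => an.
by case: h; exists a.
Qed.

(** If [theta] moves a, then 1 and a form a basis of F over the fixed field; the coordinate of z at
    a is (z - theta z) / (a - theta a). *)
Lemma card_fixF_sq : (#|fixF| * #|fixF|)%N = #|F|.
Proof.
have [a an] := theta_moved; have dn : a - theta a != 0 by rewrite subr_eq0 eq_sym.
pose f (x : F * F) := x.1 + x.2 * a.
rewrite -cardsX -(@card_in_imset _ _ f); last first.
  move=> [x y] [x' y']; rewrite !inE /f /=.
  move=> /andP [/eqP x1 /eqP y1] /andP [/eqP x2 /eqP y2] e.
  have e' : x + y * theta a = x' + y' * theta a.
    by rewrite -x1 -x2 -{1}y1 -{1}y2 -!rmorphM -!rmorphD e.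
  have yy : y = y'.
    apply: (mulIf dn); apply/eqP; rewrite -subr_eq0.
    have -> : y * (a - theta a) - y' * (a - theta a) =
      (x + y * a - (x' + y' * a)) - (x + y * theta a - (x' + y' * theta a)) by ring.
    by rewrite e e' !subrr.
  by move: e; rewrite yy => /addIr ->.
rewrite -cardsT; congr #|pred_of_set _|; apply/setP => z; rewrite inE.
pose y := (z - theta z) / (a - theta a); pose x := z - y * a.
have ty : theta y = y.
  rewrite /y fmorph_div !rmorphB !thetaK -[LHS]mulrNN -invrN !opprB //.
have tx : theta x = x.
  rewrite /x rmorphB rmorphM ty; apply/eqP; rewrite -subr_eq0.
  have -> : theta z - y * theta a - (z - y * a) = y * (a - theta a) - (z - theta z) by ring.
  by rewrite /y divfK // subrr.
apply/imsetP; exists (x, y); first by rewrite !inE tx ty !eqxx.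
by rewrite /f /= /x subrK.
Qed.

(** In characteristic 2 the trace of 1 vanishes, but a + theta a = a - theta a is nonzero when
    [theta] moves a. *)
Lemma trace_neq0 : exists a, a + theta a != 0.
Proof.
have [two|two] := eqVneq (1 + 1 : F) 0; last by exists 1; rewrite rmorph1.
have [a an] := theta_moved; exists a; rewrite addr_eq0 eq_sym.
by rewrite (_ : - theta a = theta a) //; apply/eqP; rewrite eq_sym -addr_eq0 -[theta a]mulr1 -mulrDr two mulr0.
Qed.

Lemma theta_trace a : theta (a + theta a) = a + theta a.
Proof. by rewrite rmorphD thetaK addrC. Qed.

(** The trace takes values in the fixed field, and its fibres over fixed elements are translates of
    its kernel, hence of equal size; [card_fixF_sq] gives that size. *)
Lemma card_trace s : theta s = s -> #|[set a | a + theta a == s]| = #|fixF|.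
Proof.
have fiber s' : theta s' = s' ->
    #|[set a | a + theta a == s']| = #|[set a | a + theta a == 0]|.
  move=> ts; have [t tn] := trace_neq0.
  pose b := t * (s' / (t + theta t)).
  have tb : b + theta b = s'.
    rewrite /b rmorphM fmorph_div theta_trace ts -mulrDl mulrC divfK //.
  have inj : injective (fun a => b + a) by apply: addrI.
  rewrite -[RHS](card_imset _ inj); apply: eq_card => a; rewrite !inE.
  apply/eqP/imsetP => [as'|[e + ->]].
    exists (a - b); last by rewrite addrC subrK.
    by rewrite inE rmorphB addrACA -opprD tb as' subrr.
  by rewrite inE => /eqP e0; rewrite rmorphD addrACA tb e0 addr0.
move=> ts; rewrite fiber //.
have : (\sum_(s' in fixF) #|[set a | (a + theta a == s')%R]| = #|F|)%N.
  under eq_bigr do rewrite -sum1dep_card.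
  rewrite (exchange_big_dep xpredT) //= -sum1_card; apply: eq_bigr => a _.
  rewrite (big_pred1 (a + theta a)) // => s'; rewrite inE.
  by apply/andP/eqP => [[_ /eqP ->]|->] //; rewrite theta_trace !eqxx.
rewrite (eq_bigr (fun=> #|[set a | a + theta a == 0]|)); last first.
  by move=> s'; rewrite inE => /eqP /fiber.
have pos : (0 < #|fixF|)%N by apply/card_gt0P; exists 0; rewrite inE rmorph0.
by rewrite sum_nat_const -card_fixF_sq => /eqP; rewrite eqn_pmul2l // => /eqP.
Qed.

(** The additive form of Hilbert 90: for a moved by [theta], r = s / (a - theta a) is fixed and t =
    r a works. *)
Lemma trace0_sub s : s + theta s = 0 -> exists t, s = t - theta t.
Proof.
move=> s0; have [a an] := theta_moved.
have dn : a - theta a != 0 by rewrite subr_eq0 eq_sym.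
have ts : theta s = - s by apply/eqP; rewrite -addr_eq0 addrC s0.
pose r := s / (a - theta a).
have tr : theta r = r.
  by rewrite /r fmorph_div ts rmorphB thetaK -[RHS]mulrNN -invrN opprB.
exists (r * a); rewrite rmorphM tr -mulrBr /r divfK //.
Qed.

End Trace.

Section Forms.
Variables (F : finFieldType) (V : vectType F).
Local Notation vT := (finvect_type V).

Lemma linear_hom (f : V -> F) : GRing.linear_for *%R f ->
  exists g : 'Hom(V, F^o), forall u, g u = f u.
Proof.
move=> lf; pose f' : V -> F^o := f.
pose g : {linear V -> F^o} := HB.pack f' (GRing.isLinear.Build _ _ _ _ f' lf).
by exists (linfun g) => u; rewrite lfunE.
Qed.

(** Here c = 1: for singular u, Q (w + a u) = Q w + a B(w, u) is affine in a and has one root when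
    B(w, u) != 0. *)
Lemma quadratic_polarity (Q : V -> F) :
  quadratic_form Q -> quadratic_nondegenerate Q ->
  exists p : polarity V 1, [/\ forall u, sg p u = (Q u == 0),
    forall u v, bf p v u = polarization Q u v
    & forall U, isotropic (QuadraticForm Q) U <-> iso p U].
Proof.
move=> [QZ [lin1 lin2]] nd.
have /choice [b bE] : forall v, exists g : 'Hom(V, F^o), forall u, g u = polarization Q u v.
  by move=> v; apply: linear_hom; apply: lin1.
have polC u v : polarization Q u v = polarization Q v u.
  by rewrite /polarization [u + v]addrC addrAC.
have QD u v : Q (u + v) = Q u + Q v + polarization Q u v.
  by rewrite /polarization; ring.
have Q0 : Q 0 = 0 by rewrite -(scale0r 0) QZ expr2 !mul0r.
have polZr a u v : polarization Q u (a *: v) = a * polarization Q u v.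
  have := lin2 u a v 0; rewrite !addr0 => ->.
  have -> : polarization Q u 0 = 0 by rewrite /polarization Q0 addr0 subrr subr0.
  by rewrite addr0.
have psg u : Q u = 0 -> polarization Q u u = 0.
  move=> qu; rewrite /polarization -mulr2n -scaler_nat QZ qu; ring.
unshelve eexists (@Polarity F V 1 (fun u => Q u == 0) b _ _ _ _ _ _ _).
- by move=> u v; rewrite !bE polC.
- by rewrite /= Q0.
- by move=> a u /eqP qu; rewrite /= QZ qu mulr0.
- by move=> u v /eqP qu /eqP qv; rewrite bE => bu; rewrite /= QD qu qv bu !addr0.
- by move=> u /eqP qu; rewrite bE psg.
- move=> u w /eqP qu; rewrite bE => bn.
  apply/eqP/cards1P; exists (- (Q w / polarization Q w u)); apply/setP => a.
  rewrite !inE QD QZ qu mulr0 addr0 polZr.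
  apply/eqP/eqP => [h|->]; last by rewrite mulNr divfK // addrN.
  by apply: (mulIf bn); rewrite mulNr divfK //; apply/eqP; rewrite -addr_eq0 addrC h.
- by move=> u /eqP qu h; apply: nd => // v; rewrite -bE.
split=> //= U.
split=> [iU|/isoP iU u /iU [/= /eqP //]].
apply/isoP => u uU; split; first by apply/eqP/iU.
apply/subvP => v vU; rewrite mem_perp /= bE /polarization.
by rewrite !iU ?memvD // !subr0.
Qed.

Variables (eps : bool) (theta : {rmorphism F -> F}).

Lemma hermDl (h : {hermitian V for eps & theta}) u v w :
  h (u + v) w = h u w + h v w.
Proof. exact: linearDl. Qed.

Lemma hermDr (h : {hermitian V for eps & theta}) u v w :
  h w (u + v) = h w u + h w v.
Proof. exact: linearDr. Qed.

Lemma hermZl (h : {hermitian V for eps & theta}) a u v : h (a *: u) v = a * h u v.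
Proof. exact: linearZl_LR. Qed.

Lemma hermZr (h : {hermitian V for eps & theta}) a u v :
  h u (a *: v) = theta a * h u v.
Proof. exact: linearZr_LR. Qed.

(** Common to the symplectic and unitary cases, which differ only in the number c of singular
    vectors on a line. *)
Lemma hermitian_form_polarity (h : {hermitian V for eps & theta}) (c : nat) :
  nondegenerate h ->
  (forall u w, h u u = 0 -> h w u != 0 ->
    #|[set a : F | h (w + a *: u) (w + a *: u) == 0]| = c) ->
  exists p : polarity V c, [/\ forall u, sg p u = (h u u == 0),
    forall u v, bf p v u = h u v
    & forall U : {vspace V}, {in U &, forall u v, h u v = 0} <-> iso p U].
Proof.
move=> nd line.
pose b v : 'Hom(V, F^o) := linfun (applyr h v : V -> F^o).
have bE u v : b v u = h u v by rewrite /b lfunE.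
have hC u v : h u v = 0 -> h v u = 0 by move/eqP; rewrite herm_eq0C => /eqP.
unshelve eexists (@Polarity F V c (fun u => h u u == 0) b _ _ _ _ _ _ _).
- by move=> u v; rewrite !bE => /hC.
- by rewrite /= linear0r.
- by move=> a u /eqP qu; rewrite /= hermZl hermZr qu !mulr0.
- move=> u v /eqP qu /eqP qv; rewrite bE => bu.
  by rewrite /= hermDl !hermDr qu qv bu (hC _ _ bu) !addr0.
- by move=> u /eqP qu; rewrite bE.
- by move=> u w /eqP qu; rewrite bE; apply: line.
- move=> u _ h0; apply/eqP; rewrite -memv0 -(eqP nd); apply/mem_orthovP => v _.
  by apply: hC; rewrite -bE.
split=> //= U; split=> [iU|iU u v uU vU].
  apply/isoP => u uU; split; first by apply/eqP/iU.
  by apply/subvP => v vU; rewrite mem_perp /= bE iU.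
by have := iso_perp iU vU uU; rewrite mem_perp /= bE => /eqP.
Qed.

End Forms.

Section HermSymp.
Variables (F : finFieldType) (V : vectType F).

Lemma symplectic_polarity (b : {skew_symmetric V}) : is_psymplectic b ->
  exists p : polarity V #|F|, [/\ forall u, sg p u,
    forall u v, bf p v u = b u v
    & forall U, isotropic (SymplecticForm b) U <-> iso p U].
Proof.
move=> [nd _ alt].
(* Skew symmetry gives this only in odd characteristic; in characteristic 2 it is a clause of
   [is_psymplectic]. *)
have b0 u : b u u = 0.
  have [two|two] := eqVneq (2%:R : F) 0.
    by apply: alt; rewrite inE /= two eqxx.
  have := hermC b u u; rewrite expr1 mulN1r /= => /eqP.
  rewrite -subr_eq0 opprK -mulr2n -mulr_natl mulf_eq0 (negbTE two) /= => /eqP //.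
have [|p [sE bE iE]] := @hermitian_form_polarity F V true idfun b #|F| nd.
  by move=> u w _ _; rewrite -[RHS]cardsT; apply: eq_card => a; rewrite !inE b0 eqxx.
by exists p; split=> // u; rewrite sE b0.
Qed.

(** On the line w + a u the form is h(w, w) plus the trace of a h(u, w), so the singular vectors
    correspond to a fibre of the trace. *)
Lemma unitary_polarity (theta : {rmorphism F -> F}) (h : {hermitian_sym V for theta}) :
  involutive theta -> ~ theta =1 id -> is_unitary h ->
  exists p : polarity V #|fixF theta|, [/\ forall u, sg p u = (h u u == 0),
    forall u v, bf p v u = h u v
    & forall U, isotropic (HermitianForm h) U <-> iso p U].
Proof.
move=> tK tn [nd _]; apply: hermitian_form_polarity => // u w huu hwu.
have hC x y : h x y = theta (h y x) by rewrite (hermC h) expr0 mul1r.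
rewrite -(card_trace tK tn (s := - h w w)); last by rewrite rmorphN -hC.
have huw : h u w != 0 by rewrite herm_eq0C.
have inj : injective (fun a : F => a * h u w) by apply: mulIf.
rewrite -(card_imset _ inj); apply: eq_card => b; rewrite !inE.
have expand a : h (w + a *: u) (w + a *: u) = h w w + (a * h u w + theta (a * h u w)).
  rewrite hermDl !hermDr !(hermZl, hermZr) huu rmorphM -hC; ring.
apply/imsetP/eqP => [[a + ->]|e].
  by rewrite inE expand addrC addr_eq0 => /eqP.
exists (b / h u w); last by rewrite divfK.
by rewrite inE expand divfK // e addrN.
Qed.

End HermSymp.

(** * Saturated subspaces *)

Section Saturation.
Variables (F : finFieldType) (V : vectType F) (c : nat) (p : polarity V c).
Variables (d : nat) (L : {set {vspace V}}) (k : nat).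
Local Notation sg := (sg p).
Local Notation perp := (perp p).
Local Notation orth := (orth p).
Local Notation iso := (iso p).
Local Notation gens := (gens p d).
Local Notation cov := (covered L).
Implicit Types (A B U W G H : {vspace V}) (u v : V).
Hypothesis iso_le : forall U, iso U -> (\dim U <= d)%N.
Hypothesis sp : subpolar p d L k.

Let Liso G : G \in L -> iso G := @sp_iso _ _ _ _ _ _ _ sp G.
Let Ldim G : G \in L -> \dim G = d := @sp_dim _ _ _ _ _ _ _ sp G.
Let covD u v : cov u -> cov v -> v \in perp u -> cov (u + v) := sp_covD sp (u := u) (v := v).

Lemma gen_hyp H z : iso H -> (\dim H).+1 = d -> (forall u, u \in H -> cov u) ->
  cov z -> z \in orth H -> z \notin H -> (H + <[z]>)%VS \in L.
Proof.
move=> iH dH cH cz zo zH; apply: (sp_gen sp).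
  apply/gensP; rewrite dim_add_line //; split=> //.
  exact: iso_add_line iH (cov_sg sp cz) zo.
move=> u /mem_add_line [a uaH]; rewrite -(subrK (a *: z) u).
apply: covD; [exact: cH | exact: covZ | ].
by apply: memvZ; have /orthP := zo; apply.
Qed.

Lemma hyp_exists G : G \in L -> exists H, [/\ (H <= G)%VS, (\dim H).+1 = d & iso H].
Proof.
move=> GL; have un : vpick G != 0.
  by rewrite vpick0 -dimv_eq0 (Ldim GL) -lt0n (ltn_trans _ (sp_d sp)).
exists (G :\: <[vpick G]>)%VS; have HG := diffvSl G <[vpick G]>; split=> //.
  have := dimv_cap_compl G <[vpick G]>; rewrite (capv_idPr _) ?subv_line ?memv_pick //.
  by rewrite dim_vline un (Ldim GL) add1n.
exact: isoS HG (Liso GL).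
Qed.

Lemma capN0 A B u : (A :&: B = 0)%VS -> u \in A -> u \in B -> u = 0.
Proof. by move=> AB uA uB; apply/eqP; rewrite -memv0 -AB memv_cap uA. Qed.

Section Opposite.
Variables (G1 G2 : {vspace V}).
Hypotheses (G1L : G1 \in L) (G2L : G2 \in L) (G12 : (G1 :&: G2 = 0)%VS).
Local Notation Y := (G1 + G2)%VS.

Lemma dim_opposite : \dim Y = (2 * d)%N.
Proof. by rewrite dimv_disjoint_sum // !Ldim // mul2n addnn. Qed.

Lemma dim_cap_perp_ge G u : G \in L -> (d.-1 <= \dim (G :&: perp u))%N.
Proof. by move=> GL; rewrite dim_cap_perp; case: ifP; rewrite Ldim ?leq_pred. Qed.

Section Extend.
Variable t : V.
Hypotheses (ct : cov t) (tY : t \notin Y) (satY : saturated p L Y).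

(* A covered vector [b] with [b _|_ z] but not [b _|_ t] reduces [z] to a
   vector of [z + <b>] orthogonal to [t], for which the claim is clear. *)
Lemma saturated_extend : saturated p L (Y + <[t]>)%VS.
Proof.
have st := cov_sg sp ct.
have G1Y : (G1 <= Y)%VS := addvSl _ _.
have G2Y : (G2 <= Y)%VS := addvSr _ _.
have tG1 : t \notin G1 by apply: contraNN tY; apply: (subvP G1Y).
have tG2 : t \notin G2 by apply: contraNN tY; apply: (subvP G2Y).
have YT : (Y <= Y + <[t]>)%VS := addvSl _ _.
have step1 z : z \in (Y + <[t]>)%VS -> sg z -> z \in perp t -> cov z.
  move=> /mem_add_line [a zaY] sz zt.
  have zt' : z \in perp (- a *: t) by apply: mem_perpZ.
  rewrite -(subrK (a *: t) z); apply: covD; last 1 first.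
  - by apply: memvZ; rewrite perpC memvB // memvZ // mem_perp bf_sg.
  - apply: satY => //; rewrite -scaleNr; apply: sgD => //; first exact: sgZ.
    exact/perpP.
  - exact: covZ.
have step2 z b : z \in (Y + <[t]>)%VS -> sg z -> b \in Y -> sg b -> b \in perp z ->
    b \notin perp t -> cov z.
  move=> zY sz bY sb bz bt; pose s := - (bf p t z / bf p t b).
  have bn : bf p t b != 0 by rewrite -mem_perp.
  have cb : cov (s *: b) by apply/covZ/satY.
  rewrite -(addrK (s *: b) z); apply: (covB sp) => //.
    apply: step1; first by rewrite memvD // memvZ // (subvP YT).
      apply: sgD => //; first exact: sgZ.
      by apply/perpP; rewrite perpC memvZ.
    apply/perpP; rewrite linearD linearZ /= /s.
    by rewrite [_ *: _]mulNr divfK // subrr.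
  by apply: memvZ; apply: mem_perpD => //; apply: mem_perpZ; rewrite mem_perp bf_sg.
(* Some b in G is not orthogonal to t. Subtracting a multiple of a makes it orthogonal to z, and its
   product with t is unchanged because a is orthogonal to t. *)
have step3 z G a : z \in (Y + <[t]>)%VS -> sg z -> G \in L -> (G <= Y)%VS ->
    t \notin G -> a \in G -> a \in perp t -> a \notin perp z -> cov z.
  move=> zY sz GL GY tG aG at_ az.
  have [b bG bt] := gen_Nperp iso_le sp GL st tG.
  have an : bf p z a != 0 by rewrite -mem_perp.
  pose r := bf p z b / bf p z a.
  have brG : b - r *: a \in G by rewrite memvB ?memvZ.
  apply: (step2 z (b - r *: a)) => //.
  - exact: (subvP GY).
  - exact: iso_sg (Liso GL) brG.
  - apply/perpP; rewrite linearB linearZ /= /r.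
    by rewrite [_ *: _]divfK // subrr.
  - by rewrite rpredBr // memvZ.
(* Otherwise the parts of G1 and G2 orthogonal to t, together with t, would span an isotropic
   subspace of dimension at least 2d - 1 > d. *)
have [a' a'M a'N] : exists2 a', a' \in (G2 :&: perp t)%VS & a' \notin orth (G1 :&: perp t)%VS.
  apply/subvNP; apply/negP => MM.
  have i1 : iso (G1 :&: perp t)%VS := isoS (capvSl _ _) (Liso G1L).
  have i2 : iso (G2 :&: perp t)%VS := isoS (capvSl _ _) (Liso G2L).
  have i3 := iso_add i2 i1 MM.
  have tN : t \notin (G2 :&: perp t + G1 :&: perp t)%VS.
    apply: contraNN tY; apply/subvP; rewrite addvC; apply: addvS; exact: capvSl.
  have to : t \in orth (G2 :&: perp t + G1 :&: perp t)%VS.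
    by rewrite orthE subv_add !capvSr.
  have := iso_le (iso_add_line i3 st to); rewrite dim_add_line // dimv_disjoint_sum.
    have := dim_cap_perp_ge t G1L; have := dim_cap_perp_ge t G2L; have := sp_d sp.
    by move: (\dim (G1 :&: _)%VS) (\dim (G2 :&: _)%VS) => x y; clear; lia.
  apply/eqP; rewrite -subv0 -G12 subv_cap.
  rewrite (subv_trans (capvSr _ _)) ?capvSl //=.
  by rewrite (subv_trans (capvSl _ _)) ?capvSl.
move: a'N; rewrite orthE => /subvNP [a]; rewrite memv_cap => /andP [aG1 at_] aa'.
move: a'M; rewrite memv_cap => /andP [a'G2 a't] z zY sz.
have [a'z|a'z] := boolP (a' \in perp z); last by apply: (step3 z G2 a').
have [az|az] := boolP (a \in perp z); last by apply: (step3 z G1 a).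
have sa := iso_sg (Liso G1L) aG1.
have ca : cov a := cov_mem G1L aG1.
(* Now a and a' are both orthogonal to z but not to each other, so [step3] covers z + a instead; z
   is recovered by subtracting the orthogonal covered vector a. *)
have cza : cov (z + a).
  apply: (step3 _ G2 a') => //.
  - by rewrite memvD // (subvP YT) // (subvP G1Y).
  - by apply: sgD => //; apply/perpP; rewrite perpC.
  - by rewrite perpC rpredDl -perpC // perpC.
rewrite -(addrK a z); apply: (covB sp) => //.
by apply: mem_perpD => //; rewrite mem_perp bf_sg.
Qed.

End Extend.

Section Tight.
Hypothesis tight : forall y y', y \in G1 -> y' \in G2 -> sg (y + y') -> y' \in perp y.

Lemma saturated_opposite : saturated p L Y.
Proof.
move=> u /memv_addP [y yG1 [y' y'G2 ->]] s; apply: covD; last exact: tight.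
  exact: cov_mem yG1.
exact: cov_mem y'G2.
Qed.

(* Within [G1 + G2], only two generators pass through a hyperplane of [G1]. *)
Lemma covered_outside : (2 < k)%N -> exists2 t, cov t & t \notin Y.
Proof.
move=> k2; apply: contrapT => hN.
have covY u : cov u -> u \in Y.
  by move=> cu; apply: contraT => uY; case: hN; exists u.
have [H [HG1 dH iH]] := hyp_exists G1L.
have cH u : u \in H -> cov u by move=> uH; apply: (cov_mem G1L); apply: (subvP HG1).
pose N := (G2 :&: orth H)%VS.
have iN : iso N := isoS (capvSl _ _) (Liso G2L).
have iHN : iso (H + N)%VS by apply: iso_add => //; rewrite subv_orthC capvSr.
have dHN : \dim (H + N)%VS = (\dim H + \dim N)%N.
  apply: dimv_disjoint_sum; apply/eqP; rewrite -subv0 -G12 subv_cap.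
  rewrite (subv_trans (capvSl _ _)) //= (subv_trans (capvSr _ _)) //; exact: capvSl.
suff sub : [set G in L | (H <= G)%VS] \subset [set G1; (H + N)%VS].
  have := subset_leq_card sub; rewrite (sp_hyp sp iH dH cH) cards2.
  by move: k2; case: (_ != _) => /=; clear; lia.
apply/subsetP => G; rewrite !inE => /andP [GL HG].
have [//|GG1] := eqVneq G G1; rewrite orFb.
have [z zG zG1] : exists2 z, z \in G & z \notin G1.
  by apply/subvNP; apply: contraNN GG1 => sub; rewrite eqEdim sub !Ldim /=.
have /memv_addP [y yG1 [y' y'G2 zE]] := covY z (cov_mem GL zG).
have sz := iso_sg (Liso GL) zG.
have yy' : y' \in perp y by apply: tight => //; rewrite -zE.
have y'H : y' \in orth H.
  rewrite orthE; apply/subvP => h hH; rewrite perpC.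
  have -> : y' = z - y by rewrite zE addrC addKr.
  apply: memvB; first exact: (iso_perp (Liso GL)) (subvP HG _ hH) zG.
  exact: (iso_perp (Liso G1L)) (subvP HG1 _ hH) yG1.
have y'n : y' != 0 by apply: contraNneq zG1 => y'0; rewrite zE y'0 addr0.
(* If y' were orthogonal to all of G1 it would lie in both G1 and G2. So H is all of G1 meet
   y'^perp; it contains y, whence y' is in G and G = H + <y'>. *)
have HE : H = (G1 :&: perp y')%VS.
  apply/eqP; rewrite eqEdim subv_cap HG1 -orthE y'H /= dim_cap_perp ifN.
    by rewrite (Ldim G1L) -dH.
  apply: contraNN y'n => h; apply/eqP; apply: (capN0 G12) => //.
  by apply: (gen_perp iso_le sp) => //; apply: iso_sg (Liso G2L) y'G2.
have yH : y \in H by rewrite HE memv_cap yG1 perpC.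
have y'G : y' \in G.
  have -> : y' = z - y by rewrite zE addrC addKr.
  by rewrite memvB // (subvP HG).
have Hy'G : (H + <[y']> <= G)%VS by rewrite add_lineS HG.
have Hy'N : (H + <[y']> <= H + N)%VS.
  by apply: addvS => //; rewrite subv_line memv_cap y'G2.
have dy' : \dim (H + <[y']>)%VS = d.
  rewrite dim_add_line //; apply: contraNN y'n => y'H'; apply/eqP; apply: (capN0 G12) => //.
  exact: (subvP HG1).
have e1 : (H + <[y']>)%VS = G by apply/eqP; rewrite eqEdim Hy'G dy' Ldim /=.
by apply/eqP; rewrite -e1; apply/eqP; rewrite eqEdim Hy'N dy' iso_le.
Qed.

End Tight.

Section Hermitian.
Variables (eps : bool) (theta : {rmorphism F -> F}).
Variable h : {hermitian V for eps & theta}.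
Hypothesis thetaK : involutive theta.
Hypothesis bE : forall u v, bf p v u = h u v.

Let perpE u v : (u \in perp v) = (h u v == 0).
Proof. by rewrite mem_perp bE. Qed.

Let hNl u w : h (- u) w = - h u w.
Proof. by rewrite -scaleN1r hermZl mulN1r. Qed.

Let hNr u w : h w (- u) = - h w u.
Proof. by rewrite -scaleN1r hermZr rmorphN1 mulN1r. Qed.

Let hBl u v w : h (u - v) w = h u w - h v w.
Proof. by rewrite hermDl hNl. Qed.

Let hBr u v w : h w (u - v) = h w u - h w v.
Proof. by rewrite hermDr hNr. Qed.

(* [y + y'] is split as [(a + a') + (b + b')], where [y = a + b], [y' = a' + b'],
   [a _|_ a'], [b _|_ b'] and the two summands are orthogonal. *)
Lemma covered_decomp y y' t : y \in G1 -> y' \in G2 ->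
  h y y' = t - (-1) ^+ eps * theta t -> cov (y + y').
Proof.
move=> yG1 y'G2 yy'.
have cy := cov_mem G1L yG1; have cy' := cov_mem G2L y'G2.
have [c0|cn] := eqVneq (h y y') 0.
  by apply: covD => //; rewrite perpC perpE c0.
have d1 := sp_d sp.
have [e eG1 en] : exists2 e, e \in (G1 :&: perp y')%VS & e != 0.
  exists (vpick (G1 :&: perp y')%VS); first exact: memv_pick.
  rewrite vpick0 -dimv_eq0 -lt0n; apply: leq_trans (dim_cap_perp_ge y' G1L).
  by rewrite -ltnS prednK // ltnW.
move: eG1; rewrite memv_cap perpE => /andP [eG1 /eqP ey'].
(* The first summand makes h(b, y') equal to t; adding e does not change this and keeps b - y off
   the line of y. *)
pose b := (t / h y y') *: y + e.
have bG1 : b \in G1 by rewrite memvD ?memvZ.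
have by' : h b y' = t by rewrite hermDl hermZl ey' addr0 divfK.
have byN : b - y \notin <[y]>%VS.
  apply: contraNN en => /vlineP [r br].
  have : e = (r + 1 - t / h y y') *: y.
    by rewrite scalerBl scalerDl scale1r -br subrK /b addrC addKr.
  move: (r + 1 - _) => s eE; move: ey'; rewrite eE hermZl => /eqP.
  by rewrite mulf_eq0 (negbTE cn) orbF => /eqP ->; rewrite scale0r.
have yn : y != 0.
  by apply: contraNneq cn => ->; rewrite -(scale0r 0) hermZl mul0r.
(* Otherwise G2 meet (b - y)^perp, of dimension at least d - 1, and the plane spanned by y and b - y
   would span an isotropic subspace of dimension at least d + 1. *)
have [a1 a1M a1y] : exists2 a1, a1 \in (G2 :&: perp (b - y))%VS & a1 \notin perp y.
  apply/subvNP; apply/negP => My.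
  pose U := (<[y]> + <[(b - y)%R]>)%VS.
  have UG1 : (U <= G1)%VS by rewrite add_lineS subv_line yG1 memvB.
  have iU := isoS UG1 (Liso G1L).
  have iM : iso (G2 :&: perp (b - y))%VS := isoS (capvSl _ _) (Liso G2L).
  have MU : (G2 :&: perp (b - y) <= orth U)%VS.
    rewrite orth_add_line subv_cap capvSr andbT; apply/subvP => v /(subvP My).
    by rewrite orthE subv_line perpC.
  have := iso_le (iso_add iM iU MU); rewrite dimv_disjoint_sum.
    rewrite dim_add_line // dim_vline yn; have := dim_cap_perp_ge (b - y) G2L.
    by move: d1 (\dim (G2 :&: _)%VS); clear => d1 x; lia.
  apply/eqP; rewrite -subv0 -G12 subv_cap (subv_trans (capvSr _ _)) //=.
  by rewrite (subv_trans (capvSl _ _)) ?capvSl.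
move: a1M; rewrite memv_cap perpE => /andP [a1G2 /eqP a1b].
rewrite perpE in a1y.
pose a' := ((-1) ^+ eps * theta t / h a1 y) *: a1.
have a'G2 : a' \in G2 by rewrite memvZ.
have a'y : h a' y = (-1) ^+ eps * theta t by rewrite hermZl divfK.
have a'b : h a' b = (-1) ^+ eps * theta t.
  by rewrite -(subrK y b) hermDr a'y hermZl a1b mulr0 add0r.
have epsK x : (-1) ^+ eps * theta ((-1) ^+ eps * theta x) = x.
  by rewrite rmorphM rmorph_sign thetaK signrMK.
have ya' : h y a' = t by rewrite hermC a'y epsK.
have ba' : h b a' = t by rewrite hermC a'b epsK.
have cov2 u u' : u \in G1 -> u' \in G2 -> h u u' = 0 -> cov (u + u').
  move=> uG u'G uu'; apply: covD; [exact: cov_mem uG | exact: cov_mem u'G |].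
  by rewrite perpC perpE uu'.
have -> : y + y' = ((y - b) + a') + (b + (y' - a')).
  by rewrite addrACA subrK [a' + _]addrC subrK.
apply: covD.
- by apply: cov2; rewrite ?memvB // hBl ya' ba' subrr.
- by apply: cov2; rewrite ?memvB // hBr by' ba' subrr.
clearbody b a'; rewrite perpC perpE !(hermDl, hermDr, hNl, hNr) ya' ba' by' a'b yy'.
have h0 G u v : G \in L -> u \in G -> v \in G -> h u v = 0.
  by move=> GL uG vG; apply/eqP; rewrite -perpE; apply: (iso_perp (Liso GL)).
rewrite (h0 G1 y b) ?(h0 G1 b b) ?(h0 G2 a' y') ?(h0 G2 a' a') //.
by apply/eqP; ring.
Qed.

End Hermitian.
End Opposite.
End Saturation.

(** * Embedded polar spaces *)

Section Lift.
Variables (F : finFieldType) (V : vectType F) (W : {vspace V}).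
Implicit Types (U : {vspace subvs_of W}).

Lemma mem_vs_lift U u : reflect (exists2 v, v \in U & u = vsval v) (u \in vs_lift U).
Proof.
by apply: (iffP memv_imgP) => -[v vU ->]; exists v; rewrite ?lfunE.
Qed.

Lemma vsval_lift U v : (vsval v \in vs_lift U) = (v \in U).
Proof.
apply/mem_vs_lift/idP => [[w wU /subvs_inj ->] //|vU]; by exists v.
Qed.

Lemma dim_vs_lift U : \dim (vs_lift U) = \dim U.
Proof.
apply: limg_dim_eq; apply/eqP; rewrite -subv0; apply/subvP => v.
rewrite memv_cap memv_ker lfunE /= => /andP [_ /eqP v0].
by rewrite memv0; apply/eqP/subvs_inj.
Qed.

Lemma vs_liftS U : (vs_lift U <= W)%VS.
Proof. by apply/subvP => u /mem_vs_lift [v _ ->]; apply: subvsP. Qed.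

Lemma vs_lift_inv (G : {vspace V}) : (G <= W)%VS -> exists U, vs_lift U = G.
Proof.
move=> GW; exists (linfun vsval @^-1: G)%VS; rewrite /vs_lift lpreimK //.
apply/subvP => u /(subvP GW) uW; rewrite -(vsprojK uW).
by rewrite -[vsval _]lfunE memv_img ?memvf.
Qed.

End Lift.

Section Rank.
Variables (F : finFieldType) (V : vectType F) (f : polar_form V) (d : nat).

Lemma polar_rankP : isotropic f 0 -> polar_rank f = d ->
  (forall U, isotropic f U -> (\dim U <= d)%N) /\
  exists2 U, isotropic f U & \dim U = d.
Proof.
move=> i0 <-; split=> [U iU|].
  by rewrite /polar_rank; apply: (leq_bigmax_cond (F := fun U => \dim U)); apply/asboolP.
have [|U iU e] := @eq_bigmax_cond _ [pred U | `[< isotropic f U >]] (fun U => \dim U).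
  by apply/card_gt0P; exists 0%VS; rewrite inE; apply/asboolP.
by exists U; [apply/asboolP | rewrite -e; apply: eq_bigl => U'; rewrite inE].
Qed.

Lemma polar_rank_eq : (forall U, isotropic f U -> (\dim U <= d)%N) ->
  (exists2 U, isotropic f U & \dim U = d) -> polar_rank f = d.
Proof.
move=> le [U iU dU]; apply/eqP; rewrite eqn_leq; apply/andP; split.
  by apply/bigmax_leqP => U' /asboolP; apply: le.
by rewrite -dU; apply: (leq_bigmax_cond (F := fun U => \dim U)); apply/asboolP.
Qed.

End Rank.

Section Transfer.
Variables (F : finFieldType) (V : vectType F) (c : nat) (p : polarity V c).
Variables (f : polar_form V) (d : nat).
Hypothesis isoE : forall U, isotropic f U <-> iso p U.
Hypothesis rank_f : polar_rank f = d.

Lemma iso_rank : (forall U, iso p U -> (\dim U <= d)%N) /\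
  exists2 U, iso p U & \dim U = d.
Proof.
have [|le [U iU dU]] := polar_rankP _ rank_f; first by apply/isoE/iso0.
by split=> [U' /isoE/le //|]; exists U => //; apply/isoE.
Qed.

Lemma generatorsE : generators f = gens p d.
Proof.
apply/setP => U; rewrite !inE rank_f; congr (_ && _).
by apply/asboolP/idP => /isoE.
Qed.

Lemma pointsP P : reflect (iso p P /\ \dim P = 1%N) (P \in points f).
Proof.
rewrite inE; apply: (iffP andP) => [[/asboolP /isoE ? /eqP]|[? ->]] //.
by split=> //; apply/asboolP/isoE.
Qed.

(** By [sp_gen], L consists of the covered generators, so it suffices that the isotropic subspaces
    of g are the covered isotropic subspaces. *)
Lemma embedded_subpolar (L : {set {vspace V}}) k (W : {vspace V})
    (g : polar_form (subvs_of W)) : subpolar p d L k ->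
  (forall u, covered L u -> u \in W) ->
  (forall U, isotropic g U <->
    iso p (vs_lift U) /\ forall u, u \in vs_lift U -> covered L u) ->
  [/\ polar_rank g = d, embedded_in f g & L = embedded_generators g].
Proof.
move=> sp covW gE; have [le [G0 iG0 dG0]] := iso_rank.
have LW G : G \in L -> exists2 U, vs_lift U = G & isotropic g U.
  move=> GL; have [|U UG] := @vs_lift_inv _ _ W G.
    by apply/subvP => u uG; apply/covW/(cov_mem GL).
  exists U => //; apply/gE; rewrite UG; split; first exact: (sp_iso sp GL).
  by move=> u; apply: cov_mem.
have rk : polar_rank g = d.
  apply: polar_rank_eq => [U /gE [iU _]|]; first by rewrite -dim_vs_lift le.
  have /set0Pn [G GL] := sp_neq0 sp; have [U UG iU] := LW G GL.
  by exists U => //; rewrite -dim_vs_lift UG (sp_dim sp GL).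
split=> //; first split.
- by move=> U /gE [iU _]; apply/isoE.
- move=> U; rewrite inE generatorsE rk => /andP [/asboolP /gE [iU _] /eqP dU].
  by apply/gensP; rewrite dim_vs_lift.
apply/setP => G; apply/idP/imsetP => [GL|[U + ->]].
  have [U UG iU] := LW G GL; exists U => //; rewrite inE rk -dim_vs_lift UG.
  by rewrite (sp_dim sp GL) eqxx andbT; apply/asboolP.
rewrite inE rk => /andP [/asboolP /gE [iU cU] /eqP dU].
by apply: (sp_gen sp) => //; apply/gensP; rewrite dim_vs_lift.
Qed.

(** For nondegeneracy of a restriction: a singular vector orthogonal to two opposite elements of L
    lies in both by maximality. *)
Lemma covered_perp0 (L : {set {vspace V}}) k G1 G2 v : subpolar p d L k ->
  G1 \in L -> G2 \in L -> (G1 :&: G2 = 0)%VS -> sg p v ->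
  (forall u, u \in G1 -> v \in perp p u) -> (forall u, u \in G2 -> v \in perp p u) ->
  v = 0.
Proof.
move=> sp G1L G2L G12 sv o1 o2; have [le _] := iso_rank.
apply: (capN0 G12); apply: (gen_perp le sp) => //; apply/subvP => u.
  by move=> /o1; rewrite perpC.
by move=> /o2; rewrite perpC.
Qed.

Section Weights.
Variables (R : realType) (L : {set {vspace V}}).
Local Notation vT := (finvect_type V).

Lemma degree_one_weight : degree_one_CL R f L -> exists w : vT -> R, degree1 p d L w.
Proof.
move=> [Lg [v vE]].
(* The coefficient of the point P, and 0 if P is not a point; [w] divides it evenly among the q - 1
   nonzero vectors of P. *)
pose vf (P : {vspace V}) := \sum_(i : 'I_#|points f|) (enum_val i == P)%:R * v i 0 : R.
pose w (u : vT) : R := if u == 0 then 0 else vf <[u : V]>%VS / (#|F|%:R - 1).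
have qn : #|F|%:R - 1 != 0 :> R by rewrite subr_eq0 gt_eqF // ltr1n card_field_gt1.
exists w; split.
- by rewrite -generatorsE.
- move=> u su; rewrite /w; case: eqP => // /eqP un.
  rewrite /vf big1 ?mul0r // => i _; case: eqP => [iE|]; last by rewrite mul0r.
  have /pointsP [+ _] : enum_val i \in points f by apply: enum_valP.
  rewrite iE => iu.
  by rewrite (iso_sg iu) ?memv_line in su.
- by rewrite /w eqxx.
move=> G Gg; have Gf : G \in generators f by rewrite generatorsE.
pose j := enum_rank_in Gf G.
have := congr1 (fun M : 'cV_#|generators f| => M j 0) vE.
rewrite !mxE enum_rankK_in // => ->.
under [RHS]eq_bigr do rewrite !mxE enum_rankK_in //.
rewrite /wt /w.
transitivity (\sum_(u : vT | ((u : V) \in G) && (u != 0)) \sum_(i : 'I_#|points f|)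
    (enum_val i == <[u : V]>%VS)%:R * v i 0 / (#|F|%:R - 1)).
  rewrite big_mkcond [RHS]big_mkcond; apply: eq_bigr => u _.
  case: ((u : V) \in G) => //=; case: eqP => //= _.
  by rewrite /vf mulr_suml.
rewrite exchange_big /=; apply: eq_bigr => i _.
rewrite -mulr_suml -mulr_suml -natr_sum mulrAC; congr (_ * _).
apply: (mulIf qn); rewrite divfK //.
have /pointsP [_ /dim1_line [z zn ->]] : enum_val i \in points f by apply: enum_valP.
rewrite subv_line; case: (boolP (z \in G)) => zG; last first.
  rewrite big1 ?mul0r // => u /andP [uG un]; apply/eqP; rewrite eqb0.
  by apply: contraNneq zG => zu; rewrite -subv_line zu subv_line.
rewrite mulr1n mul1r.
have -> : #|F|%:R - 1 = #|F|%:R ^+ \dim <[z]> - #|F|%:R ^+ \dim (0%VS : {vspace V}) :> R.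
  by rewrite dim_vline zn dimv0 expr1 expr0.
rewrite -(card_diffR _ (sub0v _)) -sum1dep_card big_mkcond [in RHS]big_mkcond /=.
congr _%:R; apply: eq_bigr => u _; rewrite memv0.
have [->|un] := eqVneq (u : V) 0; first by rewrite !andbF.
rewrite !andbT; have -> : (<[z]> == <[u : V]>)%VS = ((u : V) \in <[z]>%VS).
  apply/eqP/idP => [->|uz]; first exact: memv_line.
  by apply/esym/eqP; rewrite eqEdim subv_line uz !dim_vline un zn.
have [uz|_] := boolP ((u : V) \in <[z]>%VS); last by rewrite if_same.
have zG' : (<[z]> <= G)%VS by rewrite subv_line.
by rewrite (subvP zG').
Qed.

End Weights.
End Transfer.

Section Dichotomy.
Variables (R : realType) (F : finFieldType) (V : vectType F).
Local Notation q := (#|F|%:R : R).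

Lemma powR_pred (e : R) : q `^ (e - 1) = q `^ e / q.
Proof.
rewrite powRB ?powRr1 ?ler0n //.
by apply/implyP => _; rewrite pnatr_eq0 -lt0n (ltnW (card_field_gt1 F)).
Qed.

(** The condition on k is k = q^(e-1) + 1 multiplied by q, which keeps it among natural numbers for
    the arithmetic in each family. *)
Lemma CL_dichotomy (c : nat) (p : polarity V c) (t : polar_family) (d m : nat)
    (f : polar_form V) (L : {set {vspace V}}) :
  (forall U, isotropic f U <-> iso p U) -> polar_rank f = d -> (0 < d)%N ->
  (0 < c)%N -> \dim {:V} = (2 * d + m)%N ->
  (c * #|F| ^ m)%:R = q `^ polar_e R t ->
  degree_one_CL R f L -> CL_parameter R t d L <= q `^ (polar_e R t - 1) + 1 ->
  (exists S : {set {vspace V}},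
      #|S|%:R = CL_parameter R t d L /\ union_of_pencils f S L) \/
  (CL_parameter R t d L = q `^ (polar_e R t - 1) + 1 /\
   exists2 k, (k * #|F| = c * #|F| ^ m + #|F|)%N & subpolar p d L k).
Proof.
move=> isoE rk d0 c0 dimV Epow hL hle.
have [iso_le iso_ex] := iso_rank isoE rk.
have [w d1] := degree_one_weight isoE rk hL.
have q0 : q != 0 by rewrite pnatr_eq0 -lt0n (ltnW (card_field_gt1 F)).
have xE : CL_parameter R t d L = par p d m w 0.
  rewrite /CL_parameter (card_CL iso_le iso_ex dimV d0 d1).
  have -> : \prod_(k < d.-1) (q `^ (polar_e R t + k%:R) + 1) = (num_gens F c m d.-1)%:R.
    rewrite natr_prod; apply: eq_bigr => i _.
    by rewrite powRD ?q0 ?implybT // powR_mulrn ?ler0n // -Epow -natrX -natrM natrD.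
  by rewrite mulrAC divff ?mul1r // pnatr_eq0 -lt0n num_gens_gt0.
rewrite powR_pred -Epow xE in hle *.
have [[S [cardS Spt nc LE]]|[xK Ln nf pK]] := degree1_small iso_le iso_ex dimV c0 d0 d1 hle.
  left; exists S; split=> //; split.
  - by apply/subsetP => P /Spt h; apply/(pointsP isoE).
  - by move=> P P' PS P'S PP' /isoE i; case/negP: (nc _ _ PS P'S PP').
  apply/setP => G; rewrite {1}LE inE; apply/andP/bigcupP => [[Gg /exists_inP [P PS PG]]|[P PS]].
    by exists P => //; rewrite inE (generatorsE isoE rk) Gg.
  rewrite inE (generatorsE isoE rk) => /andP [Gg PG]; split=> //.
  by apply/exists_inP; exists P.
right; split=> //.
have [k kE sp] := subpolar_weights iso_le iso_ex dimV c0 d0 d1 xK Ln nf pK.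
exists k => //; apply/eqP; rewrite -(eqr_nat R) natrM kE natrD mulrDl mul1r divfK //.
Qed.

End Dichotomy.

Section Restriction.
Variables (F : finFieldType) (V : vectType F).

Section Quadratic.
Variables (p : polarity V 1) (Q : V -> F) (d k : nat) (L : {set {vspace V}}).
Hypotheses (qQ : quadratic_form Q) (nQ : quadratic_nondegenerate Q).
Hypothesis sgE : forall u, sg p u = (Q u == 0).
Hypothesis bE : forall u v, bf p v u = polarization Q u v.
Hypothesis isoE : forall U, isotropic (QuadraticForm Q) U <-> iso p U.
Hypothesis rk : polar_rank (QuadraticForm Q) = d.
Hypothesis d0 : (0 < d)%N.
Hypothesis sp : subpolar p d L k.

Lemma quadratic_tight G1 G2 : G1 \in L -> G2 \in L ->
  forall y y', y \in G1 -> y' \in G2 -> sg p (y + y') -> y' \in perp p y.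
Proof.
move=> G1L G2L y y' yG y'G.
have := iso_sg (sp_iso sp G1L) yG; have := iso_sg (sp_iso sp G2L) y'G.
rewrite !sgE => /eqP qy' /eqP qy /eqP q0; rewrite perpC mem_perp bE.
by rewrite /polarization q0 qy qy' !subr0.
Qed.

Definition restrict_quadratic (W : {vspace V}) : polar_form (subvs_of W) :=
  QuadraticForm (fun u => Q (vsval u)).

(** [saturated_hyperplane] identifies the singular vectors of W with the covered vectors. W then
    contains G1 and G2, so [covered_perp0] excludes singular vectors from the radical of the
    restriction. *)
Lemma quadratic_embedded (W G1 G2 : {vspace V}) (t : polar_family) :
  G1 \in L -> G2 \in L -> (G1 :&: G2 = 0)%VS -> saturated p L W ->
  (\dim W).+1 = \dim {:V} -> polar_vdim t d = \dim W ->
  in_family t (restrict_quadratic W) ->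
  [/\ classical_polar_space t d (restrict_quadratic W),
      embedded_in (QuadraticForm Q) (restrict_quadratic W)
    & L = embedded_generators (restrict_quadratic W)].
Proof.
move=> G1L G2L G12 satW dW dt ft; set g := restrict_quadratic W.
have covW := saturated_hyperplane sp satW dW.
have gE U : isotropic g U <->
    iso p (vs_lift U) /\ forall u, u \in vs_lift U -> covered L u.
  split=> [iU|[/isoE iU _] u uU]; last by apply: iU; rewrite vsval_lift.
  have iU' : iso p (vs_lift U).
    by apply/isoE => u /mem_vs_lift [v vU ->]; apply: iU.
  split=> // u uU; apply: satW; last exact: iso_sg iU' uU.
  by apply: (subvP (vs_liftS U)).
have [rg eg LE] := embedded_subpolar isoE rk sp covW gE.
split=> //; split=> //; last by rewrite dimvf dt.
split.
  case: qQ => [QZ [l1 l2]]; split=> [a v|]; first by rewrite linearZ /= QZ.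
  have polE u v : polarization (fun u : subvs_of W => Q (vsval u)) u v =
      polarization Q (vsval u) (vsval v) by rewrite /polarization linearD.
  split=> [v a x y|v a x y]; rewrite !polE linearP; [exact: l1 | exact: l2].
move=> v Qv vo; apply: subvs_inj.
have sv : sg p (vsval v) by rewrite sgE Qv.
have vp u : u \in W -> vsval v \in perp p u.
  move=> uW; rewrite perpC mem_perp bE -(vsprojK uW); apply/eqP.
  by rewrite -[RHS](vo (vsproj W u)) /polarization linearD.
by apply: (covered_perp0 isoE rk sp G1L G2L G12 sv) => u uG; apply/vp/covW;
  [apply: cov_mem G1L uG | apply: cov_mem G2L uG].
Qed.

End Quadratic.
End Restriction.

Section RestrictHermitian.
Variables (F : finFieldType) (V : vectType F) (theta : {rmorphism F -> F}).
Variable h : {hermitian_sym V for theta}.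

Definition restrict_form (W : {vspace V}) : subvs_of W -> subvs_of W -> F :=
  fun u v => h (vsval u) (vsval v).

Variable W : {vspace V}.
Local Notation hW := (@restrict_form W).

Fact restrict_zmodl u' : zmod_morphism (hW ^~ u').
Proof. by move=> u v; rewrite /hW linearB linearBl. Qed.

Fact restrict_zmodr u : zmod_morphism (hW u).
Proof. by move=> v v'; rewrite /hW linearB. Qed.

Fact restrict_scalel u' : scalable_for *%R (hW ^~ u').
Proof. by move=> a u; rewrite /hW linearZ hermZl. Qed.

Fact restrict_scaler u : scalable_for (theta \; *%R) (hW u).
Proof. by move=> a v; apply: hermZr. Qed.

HB.instance Definition _ := isBilinear.Build F (subvs_of W) (subvs_of W) F
  *%R (theta \; *%R) hW restrict_zmodl restrict_zmodr restrict_scalel restrict_scaler.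

Fact restrict_herm u v : hW u v = (-1) ^+ false * theta (hW v u).
Proof. exact: hermC. Qed.

HB.instance Definition _ := isHermitianSesquilinear.Build F (subvs_of W)
  false theta hW restrict_herm.

Definition restrict_hermitian : {hermitian_sym (subvs_of W) for theta} := hW.

End RestrictHermitian.

Section HermitianEmbedded.
Variables (F : finFieldType) (V : vectType F) (theta : {rmorphism F -> F}).
Variables (h : {hermitian_sym V for theta}) (c : nat) (p : polarity V c).
Variables (d k : nat) (L : {set {vspace V}}).
Hypotheses (thetaK : involutive theta) (theta_neq : ~ theta =1 id).
Hypothesis sgE : forall u, sg p u = (h u u == 0).
Hypothesis bE : forall u v, bf p v u = h u v.
Hypothesis isoE : forall U, isotropic (HermitianForm h) U <-> iso p U.
Hypothesis rk : polar_rank (HermitianForm h) = d.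
Hypothesis d0 : (0 < d)%N.
Hypothesis sp : subpolar p d L k.

(** If y, y' and y + y' are singular, h(y, y') has trace 0 and so the form t - theta t required by
    [covered_decomp]. *)
Lemma hermitian_saturated G1 G2 : G1 \in L -> G2 \in L -> (G1 :&: G2 = 0)%VS ->
  saturated p L (G1 + G2)%VS.
Proof.
move=> G1L G2L G12 u /memv_addP [y yG [y' y'G ->]]; rewrite sgE => /eqP s.
have [le _] := iso_rank isoE rk.
have s1 := iso_sg (sp_iso sp G1L) yG; have s2 := iso_sg (sp_iso sp G2L) y'G.
rewrite !sgE in s1 s2.
have [|t tE] := @trace0_sub F theta thetaK theta_neq (h y y').
  move: s; rewrite hermDl !hermDr (eqP s1) (eqP s2) add0r addr0 (hermC h y' y).
  by rewrite expr0 mul1r.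
by apply: (covered_decomp le sp G1L G2L G12 thetaK bE (t := t)); rewrite ?expr0 ?mul1r.
Qed.

Lemma hermitian_embedded (W G1 G2 : {vspace V}) (t : polar_family) :
  G1 \in L -> G2 \in L -> (G1 :&: G2 = 0)%VS -> saturated p L W ->
  (\dim W).+1 = \dim {:V} -> polar_vdim t d = \dim W ->
  in_family t (HermitianForm (restrict_hermitian h W)) ->
  [/\ classical_polar_space t d (HermitianForm (restrict_hermitian h W)),
      embedded_in (HermitianForm h) (HermitianForm (restrict_hermitian h W))
    & L = embedded_generators (HermitianForm (restrict_hermitian h W))].
Proof.
move=> G1L G2L G12 satW dW dt ft; set g := HermitianForm _ in ft *.
have covW := saturated_hyperplane sp satW dW.
have gE U : isotropic g U <->
    iso p (vs_lift U) /\ forall u, u \in vs_lift U -> covered L u.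
  split=> [iU|[/isoE iU _] u v uU vU]; last first.
    by rewrite /= /restrict_form iU ?vsval_lift.
  have iU' : iso p (vs_lift U).
    apply/isoE => u v /mem_vs_lift [u' uU ->] /mem_vs_lift [v' vU ->].
    exact: (iU u' v').
  split=> // u uU; apply: satW; last exact: iso_sg iU' uU.
  by apply: (subvP (vs_liftS U)).
have [rg eg LE] := embedded_subpolar isoE rk sp covW gE.
split=> //; split=> //; last by rewrite dimvf dt.
split=> //; split=> //.
rewrite /nondegenerate -subv0; apply/subvP => v /mem_orthovP vo.
have vp u : u \in W -> h (vsval v) u = 0.
  move=> uW; rewrite -(vsprojK uW); apply: (vo (vsproj W u)); exact: memvf.
have sv : sg p (vsval v) by rewrite sgE vp ?subvsP.
rewrite memv0; apply/eqP/subvs_inj.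
have vp' u : u \in W -> vsval v \in perp p u.
  by move=> uW; rewrite mem_perp bE vp.
by apply: (covered_perp0 isoE rk sp G1L G2L G12 sv) => u uG; apply/vp'/covW;
  [apply: cov_mem G1L uG | apply: cov_mem G2L uG].
Qed.

End HermitianEmbedded.

Section SymplecticEmbedded.
Variables (F : finFieldType) (V : vectType F) (b : {skew_symmetric V}).
Variables (c : nat) (p : polarity V c) (d : nat) (L : {set {vspace V}}).
Hypothesis sgE : forall u, sg p u.
Hypothesis bE : forall u v, bf p v u = b u v.
Hypothesis isoE : forall U, isotropic (SymplecticForm b) U <-> iso p U.
Hypothesis rk : polar_rank (SymplecticForm b) = d.
Hypothesis dimV : \dim {:V} = (2 * d)%N.
Hypothesis d0 : (0 < d)%N.
Hypothesis sp : subpolar p d L 2.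

Let b0 u : b u u = 0.
Proof. by rewrite -bE bf_sg. Qed.

Let bC u v : b u v = - b v u.
Proof. by rewrite (hermC b) expr1 mulN1r. Qed.

Variables G1 G2 : {vspace V}.
Hypotheses (G1L : G1 \in L) (G2L : G2 \in L) (G12 : (G1 :&: G2 = 0)%VS).

Let G12T : (G1 + G2)%VS = fullv.
Proof.
by apply/eqP; rewrite eqEdim subvf (dim_opposite sp) // dimV /=.
Qed.

(* In odd characteristic every vector would be covered. *)
Lemma symplectic_char2 : 1 + 1 = 0 :> F.
Proof.
apply/eqP; apply: contraT => two; have [le _] := iso_rank isoE rk.
case: (saturated_neqT sp) => u _ _; have : u \in (G1 + G2)%VS by rewrite G12T memvf.
move=> /memv_addP [y yG [y' y'G ->]].
apply: (covered_decomp le sp G1L G2L G12 _ bE (t := b y y' / (1 + 1))) => //.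
have cancel2 a : a = a / (1 + 1) + a / (1 + 1) :> F.
  by rewrite -{1}[a](divfK two) mulrDr mulr1.
by rewrite expr1 mulN1r opprK /= -cancel2.
Qed.

(** On y + y' with y in G1 and y' in G2 this is b(y, y'), as b(y, y) = 0. *)
Definition split_form (u : V) : F := b (daddv_pi G1 G2 u) u.

Let pi := daddv_pi G1 G2.

Let split_pi u : u = pi u + daddv_pi G2 G1 u.
Proof. by rewrite daddv_pi_add // G12T memvf. Qed.

Let piG1 u : pi u \in G1. Proof. exact: memv_pi. Qed.

Let pi'G2 u : daddv_pi G2 G1 u \in G2. Proof. exact: memv_pi. Qed.

Let bG G u v : G \in L -> u \in G -> v \in G -> b u v = 0.
Proof.
by move=> GL uG vG; apply/eqP; rewrite -bE -mem_perp; apply: (iso_perp (sp_iso sp GL)).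
Qed.

Lemma split_formE u : split_form u = b (pi u) (daddv_pi G2 G1 u).
Proof. by rewrite /split_form {2}(split_pi u) hermDr b0 add0r. Qed.

(* A covered [z] with [split_form z != 0] would give a third element of [L]
   through the hyperplane [z^perp] of [G1]. *)
Lemma covered_split u : covered L u <-> split_form u = 0.
Proof.
have [le _] := iso_rank isoE rk.
split=> [cu|u0]; last first.
  rewrite (split_pi u); apply: (sp_covD sp).
  - exact: cov_mem G1L (piG1 u).
  - exact: cov_mem G2L (pi'G2 u).
  - by rewrite perpC mem_perp bE -split_formE u0.
apply/eqP; apply: contraT; rewrite split_formE.
set y := pi u; set y' := daddv_pi G2 G1 u => yy'.
have uE : u = y + y' := split_pi u.
have y'n : y' != 0.
  by apply: contraNneq yy' => ->; rewrite -(scale0r 0) hermZr rmorph0 mul0r.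
pose H := (G1 :&: perp p y')%VS.
have HG1 : (H <= G1)%VS := capvSl _ _.
have iH : iso p H := isoS HG1 (sp_iso sp G1L).
have yG1 : y \in G1 := piG1 u.
have yH : y \notin H by rewrite memv_cap yG1 mem_perp bE.
have dH : (\dim H).+1 = d.
  rewrite dim_cap_perp ifN; first by rewrite (sp_dim sp G1L) prednK.
  by apply: contraNN yH => /subvP h; rewrite memv_cap yG1 h.
have cH v : v \in H -> covered L v.
  by move=> vH; apply: (cov_mem G1L); apply: (subvP HG1).
have y'o : y' \in orth p H by rewrite orthE capvSr.
have uo : u \in orth p H.
  apply/orthP => v vH; rewrite uE; apply: memvD; last by have /orthP := y'o; apply.
  exact: (iso_perp (sp_iso sp G1L)) (subvP HG1 _ vH) yG1.
have y'G1 : y' \notin G1.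
  by apply: contraNN y'n => h; apply/eqP; exact: (capN0 G12 h (pi'G2 u)).
have uG1 : u \notin G1.
  by apply: contraNN y'G1 => h; rewrite -(addKr y y') -uE addrC memvB.
have notH v : v \notin G1 -> v \notin H by apply: contraNN; apply: (subvP HG1).
have Ly' := gen_hyp sp iH dH cH (cov_mem G2L (pi'G2 u)) y'o (notH _ y'G1).
have Lu := gen_hyp sp iH dH cH cu uo (notH _ uG1).
have sub : [set G1; (H + <[y']>)%VS; (H + <[u]>)%VS] \subset [set G in L | (H <= G)%VS].
  by apply/subsetP => G; rewrite !inE => /orP [/orP [] | ] /eqP ->;
    rewrite ?G1L ?Ly' ?Lu ?addvSl.
have := subset_leq_card sub; rewrite (sp_hyp sp iH dH cH).
have mem_line v : v \in (H + <[v]>)%VS by rewrite (subvP (addvSr _ _)) ?memv_line.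
have n1 : G1 != (H + <[y']>)%VS.
  by apply: contraNneq y'G1 => ->; apply: mem_line.
have n2 : G1 != (H + <[u]>)%VS.
  by apply: contraNneq uG1 => ->; apply: mem_line.
have n3 : (H + <[y']>)%VS != (H + <[u]>)%VS.
  apply: contraNneq yH => e.
  have yM : y \in (H + <[y']>)%VS.
    have uM : u \in (H + <[y']>)%VS by rewrite e mem_line.
    by rewrite -(addrK y' y) -uE memvB ?mem_line.
  move: yM => /mem_add_line [a yaH].
  have : a *: y' \in G1.
    by rewrite -[a *: y'](subKr y) memvB // (subvP HG1).
  have [a0|an] := eqVneq a 0; first by move: yaH; rewrite a0 scale0r subr0.
  by move=> /(memvZ a^-1); rewrite scalerK // (negbTE y'G1).
by rewrite setUC cardsU1 !inE cards2 n1 ![_ == G1]eq_sym (negbTE n2) eq_sym (negbTE n3).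
Qed.

Lemma symplectic_embedded :
  exists g : polar_form (subvs_of {:V}),
  [/\ classical_polar_space Hyperbolic d g, embedded_in (SymplecticForm b) g
    & L = embedded_generators g].
Proof.
have char2 := symplectic_char2.
have polE u v : polarization split_form u v = b u v.
  have -> : polarization split_form u v = b (pi u) v + b (pi v) u.
    by rewrite /polarization /split_form -/pi [pi (u + v)]linearD hermDl !hermDr; ring.
  have e1 : b (pi u) v = b (pi u) (daddv_pi G2 G1 v).
    by rewrite {1}(split_pi v) hermDr (bG G1L (piG1 u) (piG1 v)) add0r.
  have e2 : b (pi v) u = b (pi v) (daddv_pi G2 G1 u).
    by rewrite {1}(split_pi u) hermDr (bG G1L (piG1 v) (piG1 u)) add0r.
  rewrite e1 e2 [in RHS](split_pi u) [in RHS](split_pi v) hermDl !hermDr.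
  rewrite (bG G1L (piG1 u) (piG1 v)) (bG G2L (pi'G2 u) (pi'G2 v)) add0r addr0.
  (* Skew symmetry produces a sign, which characteristic 2 absorbs. *)
  congr (_ + _); rewrite [RHS]bC; apply/eqP; rewrite -addr_eq0.
  by rewrite -[b _ _]mulr1 -mulrDr char2 mulr0.
pose g : polar_form (subvs_of {:V}) := QuadraticForm (fun u => split_form (vsval u)).
have polgE u v : polarization (fun u : subvs_of {:V} => split_form (vsval u)) u v =
    b (vsval u) (vsval v) by rewrite -polE /polarization linearD.
have gE U : isotropic g U <->
    iso p (vs_lift U) /\ forall u, u \in vs_lift U -> covered L u.
  split=> [iU|[_ cU] u uU]; last by apply/covered_split/cU; rewrite vsval_lift.
  split; last by move=> u /mem_vs_lift [v vU ->]; apply/covered_split/iU.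
  apply/isoE => u v /mem_vs_lift [u' uU ->] /mem_vs_lift [v' vU ->].
  rewrite -polgE /polarization.
  by have /= -> := iU _ (memvD uU vU); have /= -> := iU _ uU; have /= -> := iU _ vU;
    rewrite !subr0.
exists g; have [|rg eg LE] := embedded_subpolar isoE rk sp _ gE.
  by move=> u _; apply: memvf.
split=> //; split=> //; last by rewrite dimvf; apply: dimV.
split.
  split=> [a v|].
    rewrite linearZ /split_form -/pi [pi (_ *: _)]linearZ hermZl hermZr /=.
    by rewrite mulrA expr2.
  by split=> [v a x y|v a x y]; rewrite !polgE linearP /= ?hermDl ?hermDr ?hermZl ?hermZr.
move=> v _ vo; apply: subvs_inj; apply: (sg_nondeg (p := p)) => // u.
by rewrite bE -(vsprojK (memvf u)) -polgE vo.
Qed.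

End SymplecticEmbedded.

(** * The six families *)

Theorem theorem5p5 (R : realType) (F : finFieldType) (V : vectType F)
    (t : polar_family) (d : nat) (f : polar_form V)
    (L : {set {vspace V}}) (x : R)
    (hP : classical_polar_space t d f)
    (hL : degree_one_CL R f L)
    (hx : x = CL_parameter R t d L)
    (hle : x <= (#|F|%:R : R) `^ (polar_e R t - 1) + 1) :
  (exists S : {set {vspace V}},
      #|S|%:R = x /\ union_of_pencils f S L) \/
  (x = (#|F|%:R : R) `^ (polar_e R t - 1) + 1 /\
   exists (W : {vspace V}) (g : polar_form (subvs_of W)) (t' : polar_family),
     [/\ classical_polar_space t' d g,
         polar_e R t' = polar_e R t - 1,
         embedded_in f g
       & L = embedded_generators g]).
Proof.
rewrite {}hx in hle *; case: hP => d0 fax rk ft dimV.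
have q1 : (1 < #|F|)%N := card_field_gt1 F.
(* It remains, family by family, to give c and m and to build the embedded space from [subpolar]. *)
have reduce c (p : polarity V c) m : (forall U, isotropic f U <-> iso p U) ->
    (0 < c)%N -> \dim {:V} = (2 * d + m)%N ->
    (c * #|F| ^ m)%:R = (#|F|%:R : R) `^ polar_e R t ->
    (forall k, (k * #|F| = c * #|F| ^ m + #|F|)%N -> subpolar p d L k ->
      exists (W : {vspace V}) (g : polar_form (subvs_of W)) (t' : polar_family),
      [/\ classical_polar_space t' d g, polar_e R t' = polar_e R t - 1,
         embedded_in f g & L = embedded_generators g]) ->
    (exists S : {set {vspace V}},
      #|S|%:R = CL_parameter R t d L /\ union_of_pencils f S L) \/
    (CL_parameter R t d L = (#|F|%:R : R) `^ (polar_e R t - 1) + 1 /\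
    exists (W : {vspace V}) (g : polar_form (subvs_of W)) (t' : polar_family),
     [/\ classical_polar_space t' d g, polar_e R t' = polar_e R t - 1,
         embedded_in f g & L = embedded_generators g]).
  move=> isoE c0 dV Epow emb.
  have [|[xK [k kE sp]]] := CL_dichotomy isoE rk d0 c0 dV Epow hL hle; first by left.
  by right; split=> //; apply: (emb k).
case: f fax rk ft hL reduce => [Q [qQ nQ]|b pb|theta h [tK tn uh]] rk ft hL reduce.
- have [p [sgE bE isoE]] := quadratic_polarity qQ nQ.
  have [le _] := iso_rank isoE rk.
  case: t ft dimV hL hle reduce => //= _ dimV hL hle reduce.
  + apply: (reduce _ p 0%N) => //; first by rewrite addn0.
      by rewrite mul1n expn0 powRr0.
    (* Hyperbolic: k q = 1 + q is impossible for q >= 2. *)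
    move=> k kE _; exfalso; move: kE q1; rewrite mul1n expn0.
    move: #|F| => n; case: k => [|[|k]]; nia.
  + apply: (reduce _ p 1%N) => //; first by rewrite addn1.
      by rewrite mul1n expn1 powRr1.
    (* Parabolic: G1 + G2 has dimension 2d and is already a hyperplane. *)
    move=> k kE sp; have [G1 [G2 [G1L G2L G12]]] := ex_opposite le sp.
    exists (G1 + G2)%VS, (restrict_quadratic Q (G1 + G2)), Hyperbolic.
    have [||||cl em LE] := @quadratic_embedded _ _ p Q d k L qQ sgE bE isoE rk d0 sp
      (G1 + G2) G1 G2 Hyperbolic G1L G2L G12 _ _ _ _ => //.
    - exact: (saturated_opposite sp G1L G2L (quadratic_tight sgE bE sp G1L G2L)).
    - by rewrite (dim_opposite sp G1L G2L G12) dimV.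
    - by rewrite (dim_opposite sp G1L G2L G12).
    by split=> //=; rewrite subrr.
  + apply: (reduce _ p 2%N) => //; first by rewrite addn2.
      by rewrite mul1n natrX -powR_mulrn.
    move=> k kE sp; have [G1 [G2 [G1L G2L G12]]] := ex_opposite le sp.
    have tight := quadratic_tight sgE bE sp G1L G2L.
    (* Elliptic: k = q + 1 > 2, so some covered vector lies outside G1 + G2, which has codimension
       2; adding it gives a hyperplane. *)
    have [|y cy yN] := covered_outside le sp G1L G2L G12 tight.
      by move: kE q1; move: #|F| => n; case: k {sp} => [|[|[|k]]] //; nia.
    pose W := (G1 + G2 + <[y]>)%VS.
    have dW : \dim W = (2 * d).+1.
      by rewrite dim_add_line // (dim_opposite sp G1L G2L G12).
    exists W, (restrict_quadratic Q W), Parabolic.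
    have [||||cl em LE] := @quadratic_embedded _ _ p Q d k L qQ sgE bE isoE rk d0 sp
      W G1 G2 Parabolic G1L G2L G12 _ _ _ _ => //.
    - apply: (saturated_extend le sp G1L G2L G12 cy yN).
      exact: (saturated_opposite sp G1L G2L tight).
    - by rewrite dW dimV.
    by split=> //=; lra.
- have [p [sgE bE isoE]] := symplectic_polarity pb.
  have [le _] := iso_rank isoE rk.
  case: t ft dimV hL hle reduce => //= _ dimV hL hle reduce.
  apply: (reduce _ p 0%N) => //; first exact: ltnW.
  + by rewrite addn0.
  + by rewrite expn0 muln1 powRr1.
  move=> k kE sp; have [G1 [G2 [G1L G2L G12]]] := ex_opposite le sp.
  (* The equation is k q = q + q. *)
  have k2 : k = 2%N.
    by move: kE q1; rewrite expn0 muln1; move: #|F| => n; case: k {sp} => [|[|[|k]]] //; nia.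
  rewrite k2 in sp.
  have [g [cl em LE]] := symplectic_embedded sgE bE isoE rk dimV d0 sp G1L G2L G12.
  by exists {:V}%VS, g, Hyperbolic; split=> //=; rewrite subrr.
- have [p [sgE bE isoE]] := unitary_polarity tK tn uh.
  have [le _] := iso_rank isoE rk.
  have c2 := card_fixF_sq tK tn; set c := #|fixF theta| in c2 p sgE bE isoE le.
  have c0 : (0 < c)%N by move: q1; rewrite -c2; case: (c).
  have cpow : c%:R = (#|F|%:R : R) `^ (1 / 2).
    rewrite -c2 natrM -expr2 -powR_mulrn ?ler0n // -powRrM.
    by rewrite div1r mulfV ?pnatr_eq0 // powRr1 ?ler0n.
  case: t ft dimV hL hle reduce => //= _ dimV hL hle reduce.
  + apply: (reduce _ p 0%N) => //; first by rewrite addn0.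
      by rewrite expn0 muln1.
    (* With q = c^2 the equation k c^2 = c + c^2 is impossible for c >= 2. *)
    move=> k kE _; exfalso; move: kE q1; rewrite -c2 expn0 muln1.
    move: (c) c0 => n n0; case: k => [|[|k]]; nia.
  + apply: (reduce _ p 1%N) => //; first by rewrite addn1.
      rewrite expn1 natrM cpow -{2}[_%:R]powRr1 // -powRD; first by congr (_ `^ _); lra.
      by rewrite pnatr_eq0 -lt0n (ltnW q1) implybT.
    move=> k kE sp; have [G1 [G2 [G1L G2L G12]]] := ex_opposite le sp.
    exists (G1 + G2)%VS, (HermitianForm (restrict_hermitian h (G1 + G2))), HermitianOdd.
    have [||||cl em LE] := @hermitian_embedded _ _ theta h _ p d k L tK tn sgE bE isoE rk d0 sp
      (G1 + G2) G1 G2 HermitianOdd G1L G2L G12 _ _ _ _ => //.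
    - exact: (hermitian_saturated tK tn sgE bE isoE rk sp G1L G2L G12).
    - by rewrite (dim_opposite sp G1L G2L G12) dimV.
    - by rewrite (dim_opposite sp G1L G2L G12).
    by split=> //=; lra.
Qed.
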